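(* Let $X\subset\mathbb P^n$ be a projective hypersurface of degree $d$. There is a quasi-isomorphism $\mathbb L_{X/k}\to\mathcal F_1^{\bullet\vee}[-1]$, where $\mathcal F_1^{\bullet\vee}[-1]$ is the complex of $\mathcal O_X$-modules $$0\to\mathcal O_X(-d)\xrightarrow{\ \partial_{\boldsymbol u}\ }\mathcal O_X(-1)^{n+1}\xrightarrow{\ \partial_{\boldsymbol v}\ }\mathcal O_X\to0$$ concentrated in degrees $-1,0,1$.
   Context: $k$ is an algebraically closed field of characteristic $0$; $X=\operatorname{Proj}S$, $S=R/(F)$, $R=k[x_0,\dots,x_n]$, $n\ge1$, $F$ homogeneous of degree $d\ge2$ containing $x_0^d$ as a summand. The map $\partial_{\boldsymbol u}$ is $s\mapsto(s\,\partial F/\partial x_0,\dots,s\,\partial F/\partial x_n)$ and $\partial_{\boldsymbol v}$ is $(s_0,\dots,s_n)\mapsto\sum_ix_is_i$. This complex is the shifted dual (where $(-)^\vee=\mathcal Hom_{\mathcal O_X}(-,\mathcal O_X)$) of $\mathcal F_1^\bullet\colon\ \mathcal O_X\to\mathcal O_X(1)^{n+1}\to\mathcal O_X(d)$. The cotangent complex $\mathbb L_{X/k}$ is the complex with $\mathbb L^{-1}_{X/k}=\mathcal I/\mathcal I^2$, $\mathbb L^0_{X/k}=\imath^*\Omega_{\mathbb P^n}$, zero in other degrees, where $\imath\colon X\to\mathbb P^n$ is the closed immersion and $\mathcal I$ its ideal sheaf; the differential is induced by $\mathcal I\hookrightarrow\mathcal O_{\mathbb P^n}\xrightarrow{\mathrm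 d}\Omega_{\mathbb P^n}$. *)

(* Defs.v *)
From HB Require Import structures.
From mathcomp Require Import all_boot all_order all_algebra.
From mathcomp Require Import generic_quotient ring_quotient.
From mathcomp Require Import ring boolp classical_sets filter topology_structure.
From mathcomp Require Import mpoly.

Set Implicit Arguments.
Unset Strict Implicit.
Unset Printing Implicit Defensive.

Import Order.TTheory GRing.Theory.

Local Open Scope classical_set_scope.
Local Open Scope quotient_scope.
Local Open Scope ring_scope.

Record mulset (A : comNzRingType) := Mulset {
  inms :> A -> Prop;
  inms1 : inms 1;
  inmsM : forall s t, inms s -> inms t -> inms (s * t);
  inms0 : ~ inms 0 }.

Section Localization.
Variables (A : comNzRingType) (T : mulset A).

Definition preloc : Type := (A * {s : A | `[< T s >]})%type.
HB.instance Definition _ := Choice.on preloc.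

Definition mkfrac (a s : A) : preloc :=
  if pselect (T s) is left h then (a, exist _ s (asboolT h))
  else (0, exist _ 1 (asboolT (inms1 T))).

Definition loceq_prop (x y : preloc) :=
  exists2 u, T u & u * (x.1 * val y.2) = u * (y.1 * val x.2).
Definition loceq : rel preloc := fun x y => `[< loceq_prop x y >].

Lemma denP (x : preloc) : T (val x.2).
Proof. exact/asboolP/(valP x.2). Qed.

Fact loceq_refl : reflexive loceq.
Proof. by move=> x; apply/asboolP; exists 1 => //; apply: inms1. Qed.

Fact loceq_sym : ssrbool.symmetric loceq.
Proof.
by move=> x y; apply/asboolP/asboolP => -[u Tu e]; exists u.
Qed.

Fact loceq_trans : transitive loceq.
Proof.
move=> y x z /asboolP[u Tu e] /asboolP[v Tv f]; apply/asboolP.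
exists (u * v * val y.2); first by apply: inmsM (denP y); apply: inmsM.
apply: subr0_eq; transitivity
  (v * val z.2 * (u * (x.1 * val y.2) - u * (y.1 * val x.2)) +
   u * val x.2 * (v * (y.1 * val z.2) - v * (z.1 * val y.2))); first by ring.
by rewrite e f !subrr !mulr0 addr0.
Qed.

Canonical loceq_equiv := EquivRel loceq loceq_refl loceq_sym loceq_trans.

Definition locring : Type := {eq_quot loceq}.
HB.instance Definition _ := Choice.on locring.
HB.instance Definition _ := EqQuotient.on locring.

(* The fraction [a / s]; it is only meaningful for [s] in [T]. *)
Definition frac (a s : A) : locring := \pi_locring (mkfrac a s).

Lemma mkfracE a s (h : T s) : mkfrac a s = (a, exist _ s (asboolT h)).
Proof.
rewrite /mkfrac; case: pselect => // h'.
by congr (_, _); apply: val_inj.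
Qed.

Lemma frac_eq a s b t : T s -> T t ->
  frac a s = frac b t <-> exists2 u, T u & u * (a * t) = u * (b * s).
Proof.
move=> hs ht; rewrite /frac (mkfracE _ hs) (mkfracE _ ht); split.
  by move/eqP; rewrite eqmodE => /asboolP.
by move=> h; apply/eqP; rewrite eqmodE; apply/asboolP.
Qed.

Lemma fracP (x : locring) : exists a s, T s /\ x = frac a s.
Proof.
elim/quotW: x => x; exists x.1, (val x.2); split; first exact: denP.
rewrite /frac (mkfracE _ (denP x)); congr \pi.
by case: x => a s; congr (_, _); apply: val_inj.
Qed.

Let nrm (x : locring) := (repr x).1.
Let dnm (x : locring) := val (repr x).2.

Lemma dnmP x : T (dnm x). Proof. exact: denP. Qed.

Lemma reprE x : x = frac (nrm x) (dnm x).
Proof.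
rewrite /frac (mkfracE _ (dnmP x)) -{1}[x]reprK; congr \pi.
rewrite [LHS]surjective_pairing; congr (_, _); exact: val_inj.
Qed.

Definition locadd x y := frac (nrm x * dnm y + nrm y * dnm x) (dnm x * dnm y).
Definition locmul x y := frac (nrm x * nrm y) (dnm x * dnm y).
Definition locopp x := frac (- nrm x) (dnm x).

Lemma fracD a s b t : T s -> T t ->
  locadd (frac a s) (frac b t) = frac (a * t + b * s) (s * t).
Proof.
move=> hs ht; rewrite /locadd.
have /(frac_eq _ _ (dnmP _) hs)[u hu e] := esym (reprE (frac a s)).
have /(frac_eq _ _ (dnmP _) ht)[v hv f] := esym (reprE (frac b t)).
have hx := dnmP (frac a s); have hy := dnmP (frac b t).
apply/frac_eq; [exact: inmsM|exact: inmsM|exists (u * v); first exact: inmsM].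
move: (nrm (frac a s)) (dnm (frac a s)) (nrm (frac b t)) (dnm (frac b t)) e f
  {hx hy} => n1 d1 n2 d2 e f.
apply: subr0_eq; transitivity
  (v * d2 * t * (u * (n1 * s) - u * (a * d1)) +
   u * d1 * s * (v * (n2 * t) - v * (b * d2))); first by ring.
by rewrite e f !subrr !mulr0 addr0.
Qed.

Lemma fracM a s b t : T s -> T t ->
  locmul (frac a s) (frac b t) = frac (a * b) (s * t).
Proof.
move=> hs ht; rewrite /locmul.
have /(frac_eq _ _ (dnmP _) hs)[u hu e] := esym (reprE (frac a s)).
have /(frac_eq _ _ (dnmP _) ht)[v hv f] := esym (reprE (frac b t)).
have hx := dnmP (frac a s); have hy := dnmP (frac b t).
apply/frac_eq; [exact: inmsM|exact: inmsM|exists (u * v); first exact: inmsM].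
move: (nrm (frac a s)) (dnm (frac a s)) (nrm (frac b t)) (dnm (frac b t)) e f
  {hx hy} => n1 d1 n2 d2 e f.
apply: subr0_eq; transitivity
  (v * n2 * t * (u * (n1 * s) - u * (a * d1)) +
   u * a * d1 * (v * (n2 * t) - v * (b * d2))); first by ring.
by rewrite e f !subrr !mulr0 addr0.
Qed.

Lemma fracN a s : T s -> locopp (frac a s) = frac (- a) s.
Proof.
move=> hs; rewrite /locopp.
have /(frac_eq _ _ (dnmP _) hs)[u hu e] := esym (reprE (frac a s)).
apply/frac_eq => //; first exact: dnmP.
by exists u => //; rewrite !mulNr !mulrN e.
Qed.

Fact eq_frac a s b t : T s -> T t -> a * t = b * s -> frac a s = frac b t.
Proof. by move=> hs ht e; apply/frac_eq => //; exists 1; rewrite ?e //; apply: inms1. Qed.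

Let T1 := inms1 T.
Let TM := @inmsM A T.

Fact locaddA : associative locadd.
Proof.
move=> x y z; have [a [s [hs ->]]] := fracP x; have [b [t [ht ->]]] := fracP y.
have [c [r [hr ->]]] := fracP z; rewrite !fracD //; try exact: TM.
by apply: eq_frac; try ring; do ?apply: TM.
Qed.

Fact locaddC : commutative locadd.
Proof.
move=> x y; have [a [s [hs ->]]] := fracP x; have [b [t [ht ->]]] := fracP y.
by rewrite !fracD //; apply: eq_frac; try ring; do ?apply: TM.
Qed.

Fact locadd0 : left_id (frac 0 1) locadd.
Proof.
move=> x; have [a [s [hs ->]]] := fracP x.
by rewrite fracD //; apply: eq_frac; try ring; do ?apply: TM.
Qed.

Fact locaddN : left_inverse (frac 0 1) locopp locadd.
Proof.
move=> x; have [a [s [hs ->]]] := fracP x.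
by rewrite fracN // fracD //; apply: eq_frac; try ring; do ?apply: TM.
Qed.

HB.instance Definition _ :=
  GRing.isZmodule.Build locring locaddA locaddC locadd0 locaddN.

Fact locmulA : associative locmul.
Proof.
move=> x y z; have [a [s [hs ->]]] := fracP x; have [b [t [ht ->]]] := fracP y.
have [c [r [hr ->]]] := fracP z; rewrite !fracM //; try exact: TM.
by apply: eq_frac; try ring; do ?apply: TM.
Qed.

Fact locmulC : commutative locmul.
Proof.
move=> x y; have [a [s [hs ->]]] := fracP x; have [b [t [ht ->]]] := fracP y.
by rewrite !fracM //; apply: eq_frac; try ring; do ?apply: TM.
Qed.

Fact locmul1 : left_id (frac 1 1) locmul.
Proof.
move=> x; have [a [s [hs ->]]] := fracP x.
by rewrite fracM //; apply: eq_frac; try ring; do ?apply: TM.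
Qed.

Fact locmulD : left_distributive locmul locadd.
Proof.
move=> x y z; have [a [s [hs ->]]] := fracP x; have [b [t [ht ->]]] := fracP y.
have [c [r [hr ->]]] := fracP z; rewrite fracD // !fracM // ?fracD; do ?exact: TM.
by apply: eq_frac; try ring; do ?apply: TM.
Qed.

Fact loc1_neq0 : frac 1 1 != 0 :> locring.
Proof.
apply/eqP => /(frac_eq _ _ T1 T1)[u hu]; rewrite !mul0r mulr0 !mulr1 => u0.
by apply: (@inms0 _ T); rewrite -u0.
Qed.

HB.instance Definition _ := GRing.Zmodule_isComNzRing.Build locring
  locmulA locmulC locmul1 locmulD loc1_neq0.

Lemma addfrac a s b t : T s -> T t ->
  frac a s + frac b t = frac (a * t + b * s) (s * t).
Proof. exact: fracD. Qed.

Lemma mulfrac a s b t : T s -> T t -> frac a s * frac b t = frac (a * b) (s * t).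
Proof. exact: fracM. Qed.

Lemma oppfrac a s : T s -> - frac a s = frac (- a) s.
Proof. exact: fracN. Qed.

End Localization.

Section Presented.
Variables (B : comNzRingType) (G : choiceType) (rel0 : seq (B * G) -> Prop).
Implicit Types (l r : seq (B * G)) (b c : B).

Definition lscale b l := [seq (b * x.1, x.2) | x <- l].

(* A list [:: (b1, g1); ..; (bm, gm)] stands for [b1 [g1] + .. + bm [gm]].    *)
(* [preseq] is the least congruence which makes such sums into a [B]-module  *)
(* where the elements of [rel0] vanish.                                       *)
Inductive preseq : seq (B * G) -> seq (B * G) -> Prop :=
| preseq_refl l : preseq l l
| preseq_sym l1 l2 : preseq l1 l2 -> preseq l2 l1
| preseq_trans l1 l2 l3 : preseq l1 l2 -> preseq l2 l3 -> preseq l1 l3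
| preseq_cat l1 r1 l2 r2 :
    preseq l1 r1 -> preseq l2 r2 -> preseq (l1 ++ l2) (r1 ++ r2)
| preseq_comm l1 l2 : preseq (l1 ++ l2) (l2 ++ l1)
| preseq_add b c g : preseq [:: (b, g); (c, g)] [:: (b + c, g)]
| preseq_zero g : preseq [:: (0, g)] [::]
| preseq_rel b r : rel0 r -> preseq (lscale b r) [::].

Definition preseqb : rel (seq (B * G)) := fun l1 l2 => `[< preseq l1 l2 >].

Fact preseqb_refl : reflexive preseqb.
Proof. by move=> l; apply/asboolP; apply: preseq_refl. Qed.

Fact preseqb_sym : ssrbool.symmetric preseqb.
Proof. by move=> l r; apply/asboolP/asboolP; apply: preseq_sym. Qed.

Fact preseqb_trans : transitive preseqb.
Proof.
by move=> l2 l1 l3 /asboolP h /asboolP k; apply/asboolP; apply: preseq_trans k.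
Qed.

Canonical preseqb_equiv :=
  EquivRel preseqb preseqb_refl preseqb_sym preseqb_trans.

Definition presmod : Type := {eq_quot preseqb}.
HB.instance Definition _ := Choice.on presmod.
HB.instance Definition _ := EqQuotient.on presmod.

Definition lcomb l : presmod := \pi_presmod l.

Lemma lcombE l r : lcomb l = lcomb r <-> preseq l r.
Proof.
split; first by move/eqP; rewrite eqmodE => /asboolP.
by move=> h; apply/eqP; rewrite eqmodE; apply/asboolP.
Qed.

Lemma lcombP (x : presmod) : exists l, x = lcomb l.
Proof. by elim/quotW: x => l; exists l. Qed.

Lemma reprP (x : presmod) : x = lcomb (repr x).
Proof. by rewrite /lcomb reprK. Qed.

Lemma lscale_cat b l r : lscale b (l ++ r) = lscale b l ++ lscale b r.
Proof. exact: map_cat. Qed.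

Lemma lscaleA b c l : lscale b (lscale c l) = lscale (b * c) l.
Proof. by rewrite /lscale -map_comp; apply: eq_map => x /=; rewrite mulrA. Qed.

Lemma lscale1 l : lscale 1 l = l.
Proof. by rewrite /lscale -[RHS]map_id; apply: eq_map => -[b g] /=; rewrite mul1r. Qed.

Lemma preseq_scale b l r : preseq l r -> preseq (lscale b l) (lscale b r).
Proof.
elim=> {l r}.
- by move=> l; apply: preseq_refl.
- by move=> l r _; apply: preseq_sym.
- by move=> l1 l2 l3 _ h _; apply: preseq_trans.
- by move=> l1 r1 l2 r2 _ h _ k; rewrite !lscale_cat; apply: preseq_cat.
- by move=> l1 l2; rewrite !lscale_cat; apply: preseq_comm.
- by move=> c1 c2 g /=; rewrite mulrDr; apply: preseq_add.
- by move=> g /=; rewrite mulr0; apply: preseq_zero.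
- by move=> c r hr; rewrite lscaleA; apply: preseq_rel.
Qed.

Lemma preseq_catCA l1 l2 l3 : preseq (l1 ++ (l2 ++ l3)) (l2 ++ (l1 ++ l3)).
Proof.
rewrite !catA; apply: preseq_cat; [exact: preseq_comm | exact: preseq_refl].
Qed.

Lemma preseq_scaleD b c l : preseq (lscale b l ++ lscale c l) (lscale (b + c) l).
Proof.
elim: l => [|[a g] l IH] /=; first exact: preseq_refl.
apply: (preseq_trans (l2 :=
   [:: (b * a, g); (c * a, g)] ++ (lscale b l ++ lscale c l))).
  apply: (@preseq_cat [:: (b * a, g)] [:: (b * a, g)]
    (lscale b l ++ (c * a, g) :: lscale c l)
    ((c * a, g) :: (lscale b l ++ lscale c l))); first exact: preseq_refl.
  exact: (preseq_catCA (lscale b l) [:: (c * a, g)] (lscale c l)).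
rewrite mulrDl.
apply: (@preseq_cat _ [:: (b * a + c * a, g)] _ (lscale (b + c) l)) IH.
exact: preseq_add.
Qed.

Lemma preseq_scale0 l : preseq (lscale 0 l) [::].
Proof.
elim: l => [|[a g] l IH] /=; first exact: preseq_refl.
rewrite mul0r; apply: (@preseq_cat [:: (0, g)] [::] (lscale 0 l) [::]) IH.
exact: preseq_zero.
Qed.

Definition presadd (x y : presmod) := lcomb (repr x ++ repr y).
Definition presscale b (x : presmod) := lcomb (lscale b (repr x)).

Lemma presaddE l r : presadd (lcomb l) (lcomb r) = lcomb (l ++ r).
Proof. by apply/lcombE; apply: preseq_cat; apply/lcombE; rewrite -reprP. Qed.

Lemma presscaleE b l : presscale b (lcomb l) = lcomb (lscale b l).
Proof. by apply/lcombE; apply: preseq_scale; apply/lcombE; rewrite -reprP. Qed.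

Fact presaddA : associative presadd.
Proof.
move=> x y z; have [l ->] := lcombP x; have [r ->] := lcombP y.
by have [s ->] := lcombP z; rewrite !presaddE catA.
Qed.

Fact presaddC : commutative presadd.
Proof.
move=> x y; have [l ->] := lcombP x; have [r ->] := lcombP y.
by rewrite !presaddE; apply/lcombE; apply: preseq_comm.
Qed.

Fact presadd0 : left_id (lcomb [::]) presadd.
Proof. by move=> x; have [l ->] := lcombP x; rewrite presaddE. Qed.

Fact presaddN : left_inverse (lcomb [::]) (presscale (-1)) presadd.
Proof.
move=> x; have [l ->] := lcombP x; rewrite presscaleE presaddE -{2}[l]lscale1.
apply/lcombE; apply: preseq_trans (preseq_scale0 l).
by rewrite -[0](addNr 1); apply: preseq_scaleD.
Qed.

HB.instance Definition _ :=
  GRing.isZmodule.Build presmod presaddA presaddC presadd0 presaddN.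

Fact presscaleA b c x : presscale b (presscale c x) = presscale (b * c) x.
Proof. by have [l ->] := lcombP x; rewrite !presscaleE lscaleA. Qed.

Fact presscale1 : left_id 1 presscale.
Proof. by move=> x; have [l ->] := lcombP x; rewrite presscaleE lscale1. Qed.

Fact presscaleDr : right_distributive presscale +%R.
Proof.
move=> b x y; have [l ->] := lcombP x; have [r ->] := lcombP y.
by rewrite [_ + _]presaddE !presscaleE lscale_cat [RHS]presaddE.
Qed.

Fact presscaleDl x : {morph presscale^~ x : b c / b + c}.
Proof.
move=> b c /=; have [l ->] := lcombP x; rewrite !presscaleE [RHS]presaddE.
by apply/lcombE/preseq_sym/preseq_scaleD.
Qed.

HB.instance Definition _ := GRing.Zmodule_isLmodule.Build B presmod
  presscaleA presscale1 presscaleDr presscaleDl.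

Definition presgen (g : G) : presmod := lcomb [:: (1, g)].

Lemma lcomb_cat l r : lcomb (l ++ r) = lcomb l + lcomb r.
Proof. by rewrite [RHS]presaddE. Qed.

Lemma lcomb_scale b l : lcomb (lscale b l) = b *: lcomb l.
Proof. by rewrite [RHS]presscaleE. Qed.

Lemma lcombS l : lcomb l = \sum_(x <- l) x.1 *: presgen x.2.
Proof.
elim: l => [|[b g] l IH]; first by rewrite big_nil.
by rewrite big_cons -IH -lcomb_scale -lcomb_cat /= mulr1.
Qed.

Lemma presrel r : rel0 r -> \sum_(x <- r) x.1 *: presgen x.2 = 0.
Proof.
by move=> hr; rewrite -lcombS -[r]lscale1; apply/lcombE; apply: preseq_rel.
Qed.

Section SemilinearLift.
Variables (C : comNzRingType) (phi : {rmorphism B -> C}).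
Variables (N : lmodType C) (h : G -> N).
Hypothesis hrel : forall r, rel0 r -> \sum_(x <- r) phi x.1 *: h x.2 = 0.

Let lift (x : presmod) : N := \sum_(y <- repr x) phi y.1 *: h y.2.

Lemma preseq_lift l r : preseq l r ->
  \sum_(y <- l) phi y.1 *: h y.2 = \sum_(y <- r) phi y.1 *: h y.2.
Proof.
have hs b s : \sum_(y <- lscale b s) phi y.1 *: h y.2 =
              phi b *: \sum_(y <- s) phi y.1 *: h y.2.
  rewrite big_map scaler_sumr; apply: eq_bigr => y _.
  by rewrite scalerA rmorphM.
elim=> [//|? ? _ ->//|? ? ? _ -> _ ->//|? ? ? ? _ e _ f|||| ].
- by rewrite !big_cat /= e f.
- by move=> *; rewrite !big_cat /= addrC.
- by move=> *; rewrite !big_cons !big_nil /= !addr0 rmorphD scalerDl.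
- by move=> *; rewrite !big_cons !big_nil /= !addr0 rmorph0 scale0r.
- by move=> b s hr; rewrite hs hrel // scaler0 big_nil.
Qed.

Let lift_lcomb l : lift (lcomb l) = \sum_(y <- l) phi y.1 *: h y.2.
Proof. by apply: preseq_lift; apply/lcombE; rewrite -reprP. Qed.

Fact preslift_linear : linear_for (phi \; *:%R) lift.
Proof.
move=> b x y; have [l ->] := lcombP x; have [r ->] := lcombP y.
rewrite -lcomb_scale -lcomb_cat !lift_lcomb big_cat big_map /= scaler_sumr.
congr (_ + _); apply: eq_bigr => z _ /=.
by rewrite scalerA rmorphM.
Qed.

Definition presliftS : {linear presmod -> N | phi \; *:%R} :=
  HB.pack lift (GRing.isLinear.Build B presmod N (phi \; *:%R) lift
    preslift_linear).

Lemma presliftS_lcomb l : presliftS (lcomb l) = \sum_(y <- l) phi y.1 *: h y.2.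
Proof. exact: lift_lcomb. Qed.

Lemma presliftS_gen g : presliftS (presgen g) = h g.
Proof. by rewrite presliftS_lcomb big_seq1 rmorph1 scale1r. Qed.

End SemilinearLift.

Section Lift.
Variables (N : lmodType B) (h : G -> N).
Hypothesis hrel : forall r, rel0 r -> \sum_(x <- r) x.1 *: h x.2 = 0.

Let lift : presmod -> N := @presliftS B idfun N h hrel.

Definition preslift : {linear presmod -> N} :=
  HB.pack lift (GRing.isLinear.Build B presmod N *:%R lift
    (preslift_linear (phi := idfun) hrel)).

Lemma preslift_lcomb l : preslift (lcomb l) = \sum_(y <- l) y.1 *: h y.2.
Proof. exact: (presliftS_lcomb (phi := idfun)). Qed.

Lemma preslift_gen g : preslift (presgen g) = h g.
Proof. by rewrite preslift_lcomb big_seq1 scale1r. Qed.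

End Lift.
End Presented.

(* A sheaf on [T] is given, as an etale space over [T], by its stalks [E p]   *)
(* and by the predicate [reg s p]: near [p], the family of germs [s] is a     *)
(* section.  The sections over an open set [U] are the families [s] with      *)
(* [reg s p] for every [p] in [U].                                            *)
Record is_etale (T : topologicalType) (E : T -> Type)
    (reg : (forall p, E p) -> T -> Prop) : Prop := IsEtale {
  etale_near : forall s p, reg s p -> \forall q \near p, reg s q;
  etale_ext : forall s t p,
    reg s p -> (\forall q \near p, s q = t q) -> reg t p;
  etale_germ : forall p (m : E p), exists2 s, reg s p & s p = m;
  etale_eq : forall s t p,
    reg s p -> reg t p -> s p = t p -> \forall q \near p, s q = t q }.

Record ringedSpace (k : comNzRingType) := RingedSpace {
  rs_top :> topologicalType;
  rs_stalk : rs_top -> comNzRingType;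
  rs_reg : (forall p, rs_stalk p) -> rs_top -> Prop;
  rs_etale : is_etale rs_reg;
  rs_regB : forall s t p,
    rs_reg s p -> rs_reg t p -> rs_reg (fun q => s q - t q) p;
  rs_regM : forall s t p,
    rs_reg s p -> rs_reg t p -> rs_reg (fun q => s q * t q) p;
  rs_const : forall p, {rmorphism k -> rs_stalk p};
  rs_regC : forall c p, rs_reg (fun q => rs_const q c) p }.
Arguments rs_stalk {k} r p : rename.
Arguments rs_reg {k} r s p : rename.
Arguments rs_const {k} r p : rename.

Record modSheaf k (X : ringedSpace k) := ModSheaf {
  ms_stalk :> forall p : X, lmodType (rs_stalk X p);
  ms_reg : (forall p, ms_stalk p) -> X -> Prop;
  ms_etale : is_etale ms_reg;
  ms_regD : forall s t p,
    ms_reg s p -> ms_reg t p -> ms_reg (fun q => s q + t q) p;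
  ms_regZ : forall a s p,
    rs_reg X a p -> ms_reg s p -> ms_reg (fun q => a q *: s q) p }.
Arguments ms_reg {k X} m s p : rename.

Record modMap k (X : ringedSpace k) (M N : modSheaf X) := ModMap {
  mm_stalk :> forall p, {linear M p -> N p};
  mm_reg : forall s p,
    ms_reg M s p -> ms_reg N (fun q => mm_stalk q (s q)) p }.

Record ringedMap k (Y Z : ringedSpace k) := RingedMap {
  rm_pt :> Y -> Z;
  rm_cont : continuous rm_pt;
  rm_stalk : forall p, {rmorphism rs_stalk Z (rm_pt p) -> rs_stalk Y p};
  rm_const : forall p c, rm_stalk p (rs_const Z (rm_pt p) c) = rs_const Y p c;
  rm_reg : forall s p, rs_reg Z s (rm_pt p) ->
    rs_reg Y (fun q => rm_stalk q (s (rm_pt q))) p }.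
Arguments rm_stalk {k Y Z} r p : rename.

Section RingedSpaceTheory.
Variables (k : comNzRingType) (X : ringedSpace k).

Lemma rs_reg0 p : rs_reg X (fun=> 0) p.
Proof.
apply: etale_ext (rs_regC 0 p) _; first exact: rs_etale.
by apply: nearW => q; rewrite rmorph0.
Qed.

Lemma rs_reg1 p : rs_reg X (fun=> 1) p.
Proof.
apply: etale_ext (rs_regC 1 p) _; first exact: rs_etale.
by apply: nearW => q; rewrite rmorph1.
Qed.

Lemma rs_regN s p : rs_reg X s p -> rs_reg X (fun q => - s q) p.
Proof.
move=> h; apply: etale_ext (rs_regB (rs_reg0 p) h) _; first exact: rs_etale.
by apply: nearW => q; rewrite sub0r.
Qed.

Lemma rs_regD s t p :
  rs_reg X s p -> rs_reg X t p -> rs_reg X (fun q => s q + t q) p.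
Proof.
move=> h g; apply: etale_ext (rs_regB h (rs_regN g)) _; first exact: rs_etale.
by apply: nearW => q; rewrite opprK.
Qed.

Lemma ms_reg0 (M : modSheaf X) p : ms_reg M (fun=> 0) p.
Proof.
have [s hs _] := etale_germ (ms_etale M) (0 : M p).
apply: etale_ext (ms_regZ (rs_reg0 p) hs) _; first exact: ms_etale.
by apply: nearW => q; rewrite scale0r.
Qed.

Lemma rm_near (Z : ringedSpace k) (f : ringedMap X Z) p (P : Z -> Prop) :
  (\forall z \near f p, P z) -> \forall q \near p, P (f q).
Proof. exact: (@rm_cont _ _ _ f). Qed.

End RingedSpaceTheory.

Section PresentedSheaf.
Variables (k : comNzRingType) (X : ringedSpace k).
Variables (G : X -> choiceType) (regG : (forall p, G p) -> X -> Prop).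
Variable rel0 : forall p, seq (rs_stalk X p * G p) -> Prop.

Local Notation formalSum := (seq ((forall p, rs_stalk X p) * (forall p, G p))).

Fixpoint lreg (L : formalSum) (p : X) : Prop :=
  if L is x :: L' then [/\ rs_reg X x.1 p, regG x.2 p & lreg L' p] else True.

Definition leval (L : formalSum) p := [seq (x.1 p, x.2 p) | x <- L].

Definition pres_reg (s : forall p, presmod (rel0 (p := p))) (p : X) :=
  exists2 L, lreg L p & \forall q \near p, s q = lcomb _ (leval L q).

Hypothesis etG : is_etale regG.
Hypothesis relS : forall p (r : seq (rs_stalk X p * G p)), rel0 r ->
  exists L, [/\ lreg L p, leval L p = r & \forall q \near p, rel0 (leval L q)].

Let etX := rs_etale X.

Lemma leval_cat L K p : leval (L ++ K) p = leval L p ++ leval K p.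
Proof. exact: map_cat. Qed.

Lemma lreg_cat L K p : lreg L p -> lreg K p -> lreg (L ++ K) p.
Proof. by elim: L => //= x L IH [h g l] hK; split=> //; apply: IH. Qed.

Lemma lreg_near L p : lreg L p -> \forall q \near p, lreg L q.
Proof.
elim: L => [_|x L IH [h g /IH l]] /=; first exact: nearW.
by apply: filterS3 (etale_near etX h) (etale_near etG g) l.
Qed.

Lemma leval_germ p (l : seq (rs_stalk X p * G p)) :
  exists2 L, lreg L p & leval L p = l.
Proof.
elim: l => [|[b g] l [L hL eL]]; first by exists [::].
have [s hs es] := etale_germ etX b; have [t ht et] := etale_germ etG g.
by exists ((s, t) :: L); rewrite //= -/(leval L p) es et eL.
Qed.

Lemma leval_eq L K p : lreg L p -> lreg K p -> leval L p = leval K p ->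
  \forall q \near p, leval L q = leval K q.
Proof.
elim: L K => [|x L IH] [|y K] //=; first by move=> *; exact: nearW.
move=> [hx gx hL] [hy gy hK] [ex ey eL].
apply: filterS3 (etale_eq etX hx hy ex) (etale_eq etG gx gy ey) (IH _ hL hK eL).
by move=> q e1 e2 e3; rewrite e1 e2; congr (_ :: _); exact: e3.
Qed.

Definition lscaleS (a : forall p, rs_stalk X p) (L : formalSum) : formalSum :=
  [seq ((fun p => a p * x.1 p), x.2) | x <- L].

Lemma lscaleSE a L p : leval (lscaleS a L) p = lscale (a p) (leval L p).
Proof. by rewrite /leval /lscaleS /lscale -!map_comp. Qed.

Lemma lreg_scale a L p : rs_reg X a p -> lreg L p -> lreg (lscaleS a L) p.
Proof.
move=> ha; elim: L => //= x L IH [h g /IH l]; split=> //; exact: rs_regM.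
Qed.

Lemma preseq_spread p l r : preseq (rel0 (p := p)) l r ->
  forall L K, lreg L p -> lreg K p -> leval L p = l -> leval K p = r ->
  \forall q \near p, preseq (rel0 (p := q)) (leval L q) (leval K q).
Proof.
move=> h L K hL hK eL eK.
suff [L' [K' [[hL' hK' eL' eK'] H]]] : exists L' K',
    [/\ lreg L' p, lreg K' p, leval L' p = l & leval K' p = r] /\
    \forall q \near p, preseq (rel0 (p := q)) (leval L' q) (leval K' q).
  have e1 := leval_eq hL hL' (etrans eL (esym eL')).
  have e2 := leval_eq hK hK' (etrans eK (esym eK')).
  by apply: filterS3 e1 e2 H => q -> ->.
elim: h {L K hL hK eL eK} => {l r}.
- move=> l; have [L hL eL] := leval_germ l; exists L, L; split=> //.
  by apply: nearW => q; apply: preseq_refl.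
- move=> l r _ [L [K [[? ? ? ?] H]]]; exists K, L; split=> //.
  by apply: filterS H => q; apply: preseq_sym.
- move=> l1 l2 l3 _ [L [K [[hL hK eL eK] H]]] _ [L' [K' [[hL' hK' eL' eK'] H']]].
  exists L, K'; split=> //.
  apply: filterS3 H H' (leval_eq hK hL' (etrans eK (esym eL'))) => q h h' e.
  by apply: preseq_trans h _; rewrite e.
- move=> l1 r1 l2 r2 _ [L [K [[hL hK eL eK] H]]] _ [L' [K' [[hL' hK' eL' eK'] H']]].
  exists (L ++ L'), (K ++ K'); split.
    by split; rewrite ?leval_cat ?eL ?eL' ?eK ?eK' //; apply: lreg_cat.
  by apply: filterS2 H H' => q h h'; rewrite !leval_cat; apply: preseq_cat.
- move=> l1 l2; have [L hL eL] := leval_germ l1; have [K hK eK] := leval_germ l2.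
  exists (L ++ K), (K ++ L); split.
    by split; rewrite ?leval_cat ?eL ?eK //; apply: lreg_cat.
  by apply: nearW => q; rewrite !leval_cat; apply: preseq_comm.
- move=> b c g; have [s hs es] := etale_germ etX b.
  have [t ht et] := etale_germ etX c; have [u hu eu] := etale_germ etG g.
  exists [:: (s, u); (t, u)], [:: ((fun q => s q + t q), u)]; split.
    by split; rewrite /= ?es ?et ?eu //; split=> //; apply: rs_regD.
  by apply: nearW => q; apply: preseq_add.
- move=> g; have [u hu eu] := etale_germ etG g.
  exists [:: ((fun q => 0), u)], [::]; split.
    by split; rewrite /= ?eu //; split=> //; apply: rs_reg0.
  by apply: nearW => q; apply: preseq_zero.
- move=> b r /relS [L [hL eL H]]; have [s hs es] := etale_germ etX b.
  exists (lscaleS s L), [::]; split.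
    by split; rewrite ?lscaleSE ?es ?eL //; apply: lreg_scale.
  by apply: filterS H => q h; rewrite lscaleSE; apply: preseq_rel.
Qed.

Fact pres_etale : is_etale pres_reg.
Proof.
split.
- move=> s p [L hL H]; apply: filterS2 (lreg_near hL) (near_join H) => q h g.
  by exists L.
- move=> s t p [L hL H] e; exists L => //.
  by apply: filterS2 H e => q <- <-.
- move=> p m; have [l ->] := lcombP m; have [L hL eL] := leval_germ l.
  exists (fun q => lcomb _ (leval L q)); last by rewrite eL.
  by exists L => //; apply: nearW.
- move=> s t p [L hL H] [K hK H'] e.
  have e0 : lcomb (rel0 (p := p)) (leval L p) = lcomb _ (leval K p).
    by rewrite -(nbhs_singleton H) -(nbhs_singleton H').
  move/lcombE in e0.
  apply: filterS3 H H' (preseq_spread e0 hL hK erefl erefl) => q -> -> h.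
  exact/lcombE.
Qed.

Fact pres_regD s t p : pres_reg s p -> pres_reg t p ->
  pres_reg (fun q => s q + t q) p.
Proof.
move=> [L hL H] [K hK H']; exists (L ++ K); first exact: lreg_cat.
by apply: filterS2 H H' => q -> ->; rewrite leval_cat lcomb_cat.
Qed.

Fact pres_regZ a s p : rs_reg X a p -> pres_reg s p ->
  pres_reg (fun q => a q *: s q) p.
Proof.
move=> ha [L hL H]; exists (lscaleS a L); first exact: lreg_scale.
by apply: filterS H => q ->; rewrite lscaleSE lcomb_scale.
Qed.

Definition presSheaf : modSheaf X := ModSheaf pres_etale pres_regD pres_regZ.

Lemma pres_reg_gen u p : regG u p ->
  ms_reg presSheaf (fun q => presgen _ (u q)) p.
Proof.
move=> hu; exists [:: ((fun=> 1), u)]; first by split=> //; apply: rs_reg1.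
exact: nearW.
Qed.

End PresentedSheaf.

Inductive tensrel (A B : comNzRingType) (phi : A -> B) (M : lmodType A) :
    seq (B * M) -> Prop :=
| tensrelD m m' : tensrel phi [:: (1, m + m'); (- 1, m); (- 1, m')]
| tensrelZ a m : tensrel phi [:: (1, a *: m); (- phi a, m)].

Definition tensor (A B : comNzRingType) (phi : A -> B) (M : lmodType A) :
  lmodType B := presmod (@tensrel A B phi M).

Definition tens (A B : comNzRingType) (phi : A -> B) (M : lmodType A) (m : M) :
  tensor phi M := presgen (@tensrel A B phi M) m.

Lemma tensD (A B : comNzRingType) (phi : A -> B) (M : lmodType A) (x y : M) :
  tens phi (x + y) = tens phi x + tens phi y.
Proof.
have := presrel (tensrelD phi x y).
rewrite !big_cons big_nil /= addr0 scale1r !scaleN1r -opprD.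
by move/subr0_eq.
Qed.

Lemma tensZ (A B : comNzRingType) (phi : A -> B) (M : lmodType A) a (x : M) :
  tens phi (a *: x) = phi a *: tens phi x.
Proof.
have := presrel (tensrelZ phi a x).
rewrite !big_cons big_nil /= addr0 scale1r scaleNr.
by move/subr0_eq.
Qed.

Section Pullback.
Variables (k : comNzRingType) (Y Z : ringedSpace k) (f : ringedMap Y Z).
Variable M : modSheaf Z.

Definition invim_reg (t : forall p, M (f p)) (p : Y) :=
  exists2 m, ms_reg M m (f p) & \forall q \near p, t q = m (f q).

Fact invim_etale : is_etale invim_reg.
Proof.
split.
- move=> s p [m hm H].
  apply: filterS2 (rm_near (etale_near (ms_etale M) hm)) (near_join H) => q.
  by exists m.
- by move=> s t p [m hm H] e; exists m => //; apply: filterS2 H e => q <- <-.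
- move=> p m; have [s hs <-] := etale_germ (ms_etale M) m.
  by exists (fun q => s (f q)) => //; exists s => //; apply: nearW.
- move=> s t p [m hm H] [n hn H'] e.
  have e0 : m (f p) = n (f p) by rewrite -(nbhs_singleton H) -(nbhs_singleton H').
  by apply: filterS3 H H' (rm_near (etale_eq (ms_etale M) hm hn e0)) => q -> ->.
Qed.

Fact pullback_spread p (r : seq (rs_stalk Y p * M (f p))) :
  tensrel (rm_stalk f p) r -> exists L, [/\ lreg invim_reg L p,
    leval L p = r & \forall q \near p, tensrel (rm_stalk f q) (leval L q)].
Proof.
case=> [m m'|a m].
  have [s hs es] := etale_germ (ms_etale M) m.
  have [t ht et] := etale_germ (ms_etale M) m'.
  exists [:: ((fun=> 1), (fun q => s (f q) + t (f q)));
             ((fun=> -1), (fun q => s (f q))); ((fun=> -1), (fun q => t (f q)))].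
  split; [|by rewrite /= es et|by apply: nearW => q; apply: tensrelD].
  do !split; try exact: rs_reg1; try exact/rs_regN/rs_reg1.
  - by exists (fun z => s z + t z); [exact: ms_regD|exact: nearW].
  - by exists s => //; exact: nearW.
  - by exists t => //; exact: nearW.
have [s hs es] := etale_germ (ms_etale M) m.
have [b hb eb] := etale_germ (rs_etale Z) a.
exists [:: ((fun=> 1), (fun q => b (f q) *: s (f q)));
           ((fun q => - rm_stalk f q (b (f q))), (fun q => s (f q)))].
split; [|by rewrite /= es eb|by apply: nearW => q; apply: tensrelZ].
do !split; try exact: rs_reg1.
- by exists (fun z => b z *: s z); [exact: ms_regZ|exact: nearW].
- exact/rs_regN/rm_reg.
- by exists s => //; exact: nearW.
Qed.

Definition pullback : modSheaf Y :=
  @presSheaf k Y (fun p => M (f p)) invim_reg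
    (fun p => @tensrel _ _ (rm_stalk f p) (M (f p)))
    invim_etale pullback_spread.

End Pullback.

Inductive quotrel (A : comNzRingType) (M : lmodType A) (E : M -> Prop) :
    seq (A * M) -> Prop :=
| quotrelD m m' : quotrel E [:: (1, m + m'); (- 1, m); (- 1, m')]
| quotrelZ a m : quotrel E [:: (1, a *: m); (- a, m)]
| quotrel0 e : E e -> quotrel E [:: (1, e)].

Definition quotmod (A : comNzRingType) (M : lmodType A) (E : M -> Prop) :
  lmodType A := presmod (quotrel E).

Section QuotientSheaf.
Variables (k : comNzRingType) (X : ringedSpace k) (M : modSheaf X).
Variable E : forall p, M p -> Prop.
Hypothesis ES : forall p e, E (p := p) e ->
  exists s, [/\ ms_reg M s p, s p = e & \forall q \near p, E (s q)].

Fact quot_spread p (r : seq (rs_stalk X p * M p)) : quotrel (E (p := p)) r ->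
  exists L, [/\ lreg (ms_reg M) L p, leval L p = r &
    \forall q \near p, quotrel (E (p := q)) (leval L q)].
Proof.
case=> [m m'|a m|e].
- have [s hs es] := etale_germ (ms_etale M) m.
  have [t ht et] := etale_germ (ms_etale M) m'.
  exists [:: ((fun=> 1), (fun q => s q + t q)); ((fun=> -1), s); ((fun=> -1), t)].
  split; [|by rewrite /= es et|by apply: nearW => q; apply: quotrelD].
  by do !split; try exact: rs_reg1; try exact/rs_regN/rs_reg1; try exact: ms_regD.
- have [s hs es] := etale_germ (ms_etale M) m.
  have [b hb eb] := etale_germ (rs_etale X) a.
  exists [:: ((fun=> 1), (fun q => b q *: s q)); ((fun q => - b q), s)].
  split; [|by rewrite /= es eb|by apply: nearW => q; apply: quotrelZ].
  by do !split; try exact: rs_reg1; try exact: rs_regN; try exact: ms_regZ.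
- move=> /ES [s [hs <- H]]; exists [:: ((fun=> 1), s)]; split=> //.
    by do !split => //; exact: rs_reg1.
  by apply: filterS H => q; apply: quotrel0.
Qed.

Definition quotSheaf : modSheaf X :=
  @presSheaf k X (fun p => M p) (ms_reg M) (fun p => quotrel (E (p := p)))
    (ms_etale M) quot_spread.

End QuotientSheaf.

Inductive kaehlerrel (k A : comNzRingType) (c : k -> A) : seq (A * A) -> Prop :=
| kaehlerD a b : kaehlerrel c [:: (1, a + b); (- 1, a); (- 1, b)]
| kaehlerM a b : kaehlerrel c [:: (1, a * b); (- a, b); (- b, a)]
| kaehlerC x : kaehlerrel c [:: (1, c x)].

Definition kaehler (k A : comNzRingType) (c : k -> A) : lmodType A :=
  presmod (kaehlerrel c).
Definition deriv (k A : comNzRingType) (c : k -> A) (a : A) : kaehler c :=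
  presgen (kaehlerrel c) a.

Lemma derivD (k A : comNzRingType) (c : k -> A) (x y : A) :
  deriv c (x + y) = deriv c x + deriv c y.
Proof.
have := presrel (kaehlerD c x y).
rewrite !big_cons big_nil /= addr0 scale1r !scaleN1r -opprD.
by move/subr0_eq.
Qed.

Lemma derivM (k A : comNzRingType) (c : k -> A) (x y : A) :
  deriv c (x * y) = x *: deriv c y + y *: deriv c x.
Proof.
have := presrel (kaehlerM c x y).
rewrite !big_cons big_nil /= addr0 scale1r !scaleNr -opprD.
by move/subr0_eq.
Qed.

Section Differentials.
Variables (k : comNzRingType) (X : ringedSpace k).

Fact kaehler_spread p (r : seq (rs_stalk X p * rs_stalk X p)) :
  kaehlerrel (rs_const X p) r ->
  exists L, [/\ lreg (rs_reg X) L p, leval L p = r &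
    \forall q \near p, kaehlerrel (rs_const X q) (leval L q)].
Proof.
case=> [a b|a b|x].
- have [s hs <-] := etale_germ (rs_etale X) a.
  have [t ht <-] := etale_germ (rs_etale X) b.
  exists [:: ((fun=> 1), (fun q => s q + t q)); ((fun=> -1), s); ((fun=> -1), t)].
  split=> //; last by apply: nearW => q; apply: kaehlerD.
  by do !split; try exact: rs_reg1; try exact/rs_regN/rs_reg1; try exact: rs_regD.
- have [s hs <-] := etale_germ (rs_etale X) a.
  have [t ht <-] := etale_germ (rs_etale X) b.
  exists [:: ((fun=> 1), (fun q => s q * t q));
             ((fun q => - s q), t); ((fun q => - t q), s)].
  split=> //; last by apply: nearW => q; apply: kaehlerM.
  by do !split; try exact: rs_reg1; try exact: rs_regN; try exact: rs_regM.
- exists [:: ((fun=> 1), (fun q => rs_const X q x))]; split=> //.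
    by do !split; [exact: rs_reg1|exact: rs_regC].
  by apply: nearW => q; apply: kaehlerC.
Qed.

Definition Omega : modSheaf X :=
  @presSheaf k X (fun p => rs_stalk X p) (rs_reg X)
    (fun p => kaehlerrel (rs_const X p)) (rs_etale X) kaehler_spread.

End Differentials.

Section IdealSheaf.
Variables (k : comNzRingType) (Y Z : ringedSpace k) (f : ringedMap Y Z).

Definition vanishes (s : forall z, rs_stalk Z z) (z : Z) :=
  \forall w \near z, forall y, f y = w -> rm_stalk f y (s (f y)) = 0.

(* The stalk at [z] of the kernel of [O_Z -> f_* O_Y].                        *)
Definition inker z (x : rs_stalk Z z) :=
  exists s, [/\ rs_reg Z s z, s z = x & vanishes s z].
Definition inkerb z : {pred (rs_stalk Z z)^o} := fun x => `[< inker x >].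

Fact inkerb_submod z : submod_closed (@inkerb z).
Proof.
split; first apply/asboolP.
  exists (fun=> 0); split=> //; first exact: rs_reg0.
  by apply: nearW => w y _; rewrite rmorph0.
move=> a x y /asboolP[s [hs <- H]] /asboolP[t [ht <- H']]; apply/asboolP.
have [b hb <-] := etale_germ (rs_etale Z) a.
exists (fun q => b q * s q + t q); split=> //.
  by apply: rs_regD => //; apply: rs_regM.
apply: filterS2 H H' => w e1 e2 v ev.
by rewrite rmorphD rmorphM (e1 _ ev) (e2 _ ev) mulr0 addr0.
Qed.

HB.instance Definition _ z := GRing.isSubmodClosed.Build _ _ (@inkerb z)
  (inkerb_submod z).

Record ideal_stalk z := IdealStalk {
  ideal_val :> (rs_stalk Z z)^o; _ : ideal_val \in @inkerb z }.
HB.instance Definition _ z := [isSub for @ideal_val z].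
HB.instance Definition _ z := [Choice of ideal_stalk z by <:].
HB.instance Definition _ z := [SubChoice_isSubLmodule of ideal_stalk z by <:].

Definition ideal_reg (s : forall z, ideal_stalk z) (z : Z) :=
  rs_reg Z (fun w => ideal_val (s w)) z.

Lemma ideal_lift s z : rs_reg Z s z -> vanishes s z ->
  exists2 t, ideal_reg t z & \forall w \near z, ideal_val (t w) = s w.
Proof.
move=> hs H; exists (fun w => insubd (0 : ideal_stalk w) (s w)); last first.
  apply: filterS2 (etale_near (rs_etale Z) hs) (near_join H) => w hw Hw.
  by rewrite insubdK //; apply/asboolP; exists s.
apply: (etale_ext (rs_etale Z) hs).
apply: filterS2 (etale_near (rs_etale Z) hs) (near_join H) => w hw Hw.
by rewrite [RHS]insubdK //; apply/asboolP; exists s.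
Qed.

Fact ideal_etale : is_etale ideal_reg.
Proof.
split.
- by move=> s p /(etale_near (rs_etale Z)).
- move=> s t p hs e; apply: (etale_ext (rs_etale Z) hs).
  by apply: filterS e => q ->.
- move=> p m; have /asboolP[s [hs es H]] := valP m.
  have [t ht e] := ideal_lift hs H; exists t => //.
  by apply: val_inj; rewrite /= (nbhs_singleton e).
- move=> s t p hs ht e.
  apply: filterS (etale_eq (rs_etale Z) hs ht (congr1 _ e)) => q.
  exact: val_inj.
Qed.

Fact ideal_regD s t p : ideal_reg s p -> ideal_reg t p ->
  ideal_reg (fun q => s q + t q) p.
Proof. exact: rs_regD. Qed.

Fact ideal_regZ a s p : rs_reg Z a p -> ideal_reg s p ->
  ideal_reg (fun q => a q *: s q) p.
Proof. exact: rs_regM. Qed.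

Definition idealSheaf : modSheaf Z := ModSheaf ideal_etale ideal_regD ideal_regZ.

Definition ideal_prod z (e : idealSheaf z) :=
  exists x y : ideal_stalk z, e = (ideal_val x : rs_stalk Z z) *: y.

Fact ideal_prod_spread z (e : idealSheaf z) : ideal_prod e ->
  exists s, [/\ ms_reg idealSheaf s z, s z = e & \forall w \near z, ideal_prod (s w)].
Proof.
move=> [x [y ->]]; have [s hs <-] := etale_germ (ms_etale idealSheaf) x.
have [t ht <-] := etale_germ (ms_etale idealSheaf) y.
exists (fun w => (ideal_val (s w) : rs_stalk Z w) *: t w); split=> //.
  exact: (ms_regZ (m := idealSheaf) hs ht).
by apply: nearW => w; exists (s w), (t w).
Qed.

Definition idealQuot : modSheaf Z := quotSheaf ideal_prod_spread.

(* [I / I^2] is a sheaf of [O_Z]-modules killed by [I].  Regarded as a sheaf  *)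
(* of [O_Y]-modules, for [f] a closed immersion, it is its inverse image.     *)
Definition conormal : modSheaf Y := pullback f idealQuot.

End IdealSheaf.

Section PresMap.
Variables (k : comNzRingType) (X : ringedSpace k).
Variables (G : X -> choiceType) (regG : (forall p, G p) -> X -> Prop).
Variable rel0 : forall p, seq (rs_stalk X p * G p) -> Prop.
Hypothesis etG : is_etale regG.
Hypothesis relS : forall p (r : seq (rs_stalk X p * G p)), rel0 r ->
  exists L, [/\ lreg regG L p, leval L p = r & \forall q \near p, rel0 (leval L q)].
Variables (N : modSheaf X) (h : forall p, G p -> N p).
Hypothesis hrel : forall p (r : seq (rs_stalk X p * G p)), rel0 r ->
  \sum_(x <- r) x.1 *: h x.2 = 0.
Hypothesis hreg : forall u p, regG u p -> ms_reg N (fun q => h (u q)) p.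

Fact presMap_reg s p : ms_reg (presSheaf etG relS) s p ->
  ms_reg N (fun q => preslift (hrel (p := q)) (s q)) p.
Proof.
move=> [L hL H]; apply: (etale_ext (ms_etale N)
    (s := fun q => \sum_(x <- L) x.1 q *: h (x.2 q))); last first.
  by apply: filterS H => q ->; rewrite preslift_lcomb big_map.
elim: L hL {H} => [_|x L IH [hx gx /IH H]].
  apply: (etale_ext (ms_etale N) (ms_reg0 N p)).
  by apply: nearW => q; rewrite big_nil.
apply: (etale_ext (ms_etale N) (ms_regD (ms_regZ hx (hreg gx)) H)).
by apply: nearW => q; rewrite big_cons.
Qed.

Definition presMap : modMap (presSheaf etG relS) N := ModMap presMap_reg.

End PresMap.

Section ConormalMap.
Variables (k : comNzRingType) (Y Z : ringedSpace k) (f : ringedMap Y Z).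

Let PO := pullback f (Omega Z).

Definition pderiv p (x : rs_stalk Z (f p)) : PO p :=
  tens (rm_stalk f p) (deriv (rs_const Z (f p)) x).

Lemma pderivD p (x y : rs_stalk Z (f p)) : pderiv (x + y) = pderiv x + pderiv y.
Proof. by rewrite /pderiv derivD tensD. Qed.

Lemma pderivM p (x y : rs_stalk Z (f p)) :
  pderiv (x * y) = rm_stalk f p x *: pderiv y + rm_stalk f p y *: pderiv x.
Proof. by rewrite /pderiv derivM tensD !tensZ. Qed.

Lemma ideal_vanish p (x : ideal_stalk f (f p)) : rm_stalk f p (ideal_val x) = 0.
Proof. by have /asboolP[s [_ <- /nbhs_singleton]] := valP x; apply. Qed.

Let d0 p (x : idealSheaf f (f p)) : PO p := pderiv (ideal_val x).

Fact conormal_rel1 p (r : seq (rs_stalk Z (f p) * idealSheaf f (f p))) :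
  quotrel (@ideal_prod _ _ _ f (f p)) r ->
  \sum_(x <- r) rm_stalk f p x.1 *: d0 x.2 = 0.
Proof.
case=> [m m'|a m|e [x [y ->]]]; rewrite !big_cons big_nil /= addr0 /d0
  ?rmorphN ?rmorph1 ?scale1r ?scaleN1r ?scaleNr.
- by rewrite pderivD addrACA !subrr addr0.
- have /= := pderivM a (ideal_val m); rewrite ideal_vanish scale0r addr0 => <-.
  exact: subrr.
- by rewrite [LHS]pderivM !ideal_vanish !scale0r addr0.
Qed.

Let d1 p (x : idealQuot f (f p)) : PO p :=
  presliftS (@conormal_rel1 p) x.

Fact conormal_rel2 p (r : seq (rs_stalk Y p * idealQuot f (f p))) :
  tensrel (rm_stalk f p) r -> \sum_(x <- r) x.1 *: d1 x.2 = 0.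
Proof.
case=> [m m'|a m]; rewrite !big_cons big_nil /= addr0 /d1 ?scale1r ?scaleN1r.
  by rewrite linearD addrACA !subrr addr0.
by rewrite linearZ /= scaleNr subrr.
Qed.

Fact conormal_reg u p : invim_reg (f := f) (M := idealQuot f) u p ->
  ms_reg PO (fun q => d1 (u q)) p.
Proof.
move=> [m [L hL H] e]; apply: (etale_ext (ms_etale PO)
  (s := fun q => \sum_(x <- L) rm_stalk f q (x.1 (f q)) *: d0 (x.2 (f q)))).
  elim: L hL {H} => [_|x L IH [hx gx /IH H]].
    apply: (etale_ext (ms_etale PO) (ms_reg0 PO p)).
    by apply: nearW => q; rewrite big_nil.
  apply: (etale_ext (ms_etale PO)
    (ms_regD (s := fun q => rm_stalk f q (x.1 (f q)) *: d0 (x.2 (f q))) _ H)).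
    apply: ms_regZ; first exact: rm_reg.
    apply: pres_reg_gen.
    exists (fun z => deriv (rs_const Z z) (ideal_val (x.2 z))); last exact: nearW.
    exact: (@pres_reg_gen _ _ _ _ _ (rs_etale Z) (@kaehler_spread k Z) _ _ gx).
  by apply: nearW => q; rewrite big_cons.
apply: filterS2 e (rm_near H) => q -> ->.
by rewrite /d1 presliftS_lcomb big_map.
Qed.

Definition conormalMap : modMap (conormal f) (pullback f (Omega Z)) :=
  presMap (invim_etale f (idealQuot f)) (@pullback_spread _ _ _ f (idealQuot f))
    conormal_rel2 conormal_reg.

Lemma conormalMapE p (x : ideal_stalk f (f p)) :
  conormalMap p (tens (rm_stalk f p) (presgen (quotrel (@ideal_prod _ _ _ f (f p))) x)) =
  pderiv (ideal_val x).
Proof. by rewrite [LHS]preslift_gen /d1 presliftS_gen. Qed.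

End ConormalMap.

Section ZeroSheaf.
Variables (k : comNzRingType) (X : ringedSpace k).

Let z0 (p : X) := 'rV[rs_stalk X p]_0.

Fact zero_etale : is_etale (fun (_ : forall p, z0 p) (_ : X) => True).
Proof.
split=> //.
- by move=> *; apply: nearW.
- by move=> p m; exists (fun=> 0) => //; apply/rowP; case.
- by move=> s t p *; apply: nearW => q; apply/rowP; case.
Qed.

Definition zeroSheaf : modSheaf X :=
  @ModSheaf k X (fun p => z0 p : lmodType (rs_stalk X p)) (fun _ _ => True)
    zero_etale (fun _ _ _ _ _ => I) (fun _ _ _ _ _ => I).

Variables M N : modSheaf X.

Let zfun p : {linear M p -> N p} := \0.

Fact zeroMap_reg s p : ms_reg M s p -> ms_reg N (fun q => zfun q (s q)) p.
Proof. by move=> _; apply: ms_reg0. Qed.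

Definition zeroMap : modMap M N := ModMap zeroMap_reg.

End ZeroSheaf.

Record complex k (X : ringedSpace k) := Complex {
  cx_obj :> int -> modSheaf X;
  cx_d : forall i, modMap (cx_obj i) (cx_obj (i + 1));
  cx_dd : forall i p (x : cx_obj i p), cx_d (i + 1) p (cx_d i p x) = 0 }.
Arguments cx_d {k X} c i : rename.

Record chainMap k (X : ringedSpace k) (C D : complex X) := ChainMap {
  cm_map :> forall i, modMap (C i) (D i);
  cm_comm : forall i p (x : C i p),
    cm_map (i + 1) p (cx_d C i p x) = cx_d D i p (cm_map i p x) }.

(* For every [i], the map on the cohomology sheaves [H^(i + 1)] is bijective  *)
(* on stalks, the stalk of [H^(i + 1) C] at [p] being the quotient of the     *)
(* kernel of [d^(i + 1)] by the image of [d^i], on [C (i + 1) p].             *)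
Definition quasi_iso k (X : ringedSpace k) (C D : complex X)
    (f : chainMap C D) : Prop :=
  forall i (p : X),
  (forall x : C (i + 1) p, cx_d C (i + 1) p x = 0 ->
     (exists y, f (i + 1) p x = cx_d D i p y) -> exists z, x = cx_d C i p z) /\
  (forall y : D (i + 1) p, cx_d D (i + 1) p y = 0 ->
     exists2 x : C (i + 1) p, cx_d C (i + 1) p x = 0 &
       exists z, y = f (i + 1) p x + cx_d D i p z).

Section ThreeTerms.
Variables (k : comNzRingType) (X : ringedSpace k) (A B C : modSheaf X).
Variables (u : modMap A B) (v : modMap B C).
Hypothesis vu : forall p (x : A p), v p (u p x) = 0.

Definition cx3_obj (i : int) : modSheaf X :=
  match i with
  | Negz 0 => A
  | Posz 0 => B
  | Posz 1 => C
  | _ => zeroSheaf X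
  end.

Definition cx3_d (i : int) : modMap (cx3_obj i) (cx3_obj (i + 1)) :=
  match i return modMap (cx3_obj i) (cx3_obj (i + 1)) with
  | Negz 0 => u
  | Posz 0 => v
  | _ => zeroMap _ _
  end.

Fact cx3_dd i p (x : cx3_obj i p) : cx3_d (i + 1) p (cx3_d i p x) = 0.
Proof. by case: i x => [[|n]|[|n]] x //=; rewrite ?raddf0 //; apply: vu. Qed.

Definition cx3 : complex X := Complex cx3_dd.

End ThreeTerms.

Section Powers.
Variables (k : comNzRingType) (X : ringedSpace k) (M N : modSheaf X) (n : nat).

Definition pow_reg (s : forall p, {ffun 'I_n -> N p}) (p : X) :=
  forall i, ms_reg N (fun q => s q i) p.

Lemma near_ord (p : X) (P : 'I_n -> X -> Prop) :
  (forall i, \forall q \near p, P i q) -> \forall q \near p, forall i, P i q.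
Proof.
move=> H; suff : \forall q \near p, forall i, i \in enum 'I_n -> P i q.
  by apply: filterS => q h i; apply: h; rewrite mem_enum.
elim: (enum _) => [|i s IH]; first exact: nearW.
apply: filterS2 (H i) IH => q h1 h2 j; rewrite inE => /predU1P[-> //|].
exact: h2.
Qed.

Fact pow_etale : is_etale pow_reg.
Proof.
split.
- move=> s p h; apply: near_ord => i; exact: (etale_near (ms_etale N) (h i)).
- move=> s t p h e i; apply: (etale_ext (ms_etale N) (h i)).
  by apply: filterS e => q ->.
- move=> p m.
  have /choice[s hs] : forall i, exists s, ms_reg N s p /\ s p = m i.
    by move=> i; have [s ? ?] := etale_germ (ms_etale N) (m i); exists s.
  exists (fun q => [ffun i => s i q]).
    move=> i; apply: (etale_ext (ms_etale N) (hs i).1).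
    by apply: nearW => q; rewrite ffunE.
  by apply/ffunP => i; rewrite ffunE (hs i).2.
- move=> s t p hs ht e.
  have : \forall q \near p, forall i, s q i = t q i.
    apply: near_ord => i.
    by apply: (etale_eq (ms_etale N) (hs i) (ht i)); rewrite e.
  by apply: filterS => q h; apply/ffunP.
Qed.

Fact pow_regD s t p : pow_reg s p -> pow_reg t p ->
  pow_reg (fun q => s q + t q) p.
Proof.
move=> hs ht i; apply: (etale_ext (ms_etale N) (ms_regD (hs i) (ht i))).
by apply: nearW => q; rewrite ffunE.
Qed.

Fact pow_regZ a s p : rs_reg X a p -> pow_reg s p ->
  pow_reg (fun q => a q *: s q) p.
Proof.
move=> ha hs i; apply: (etale_ext (ms_etale N) (ms_regZ ha (hs i))).
by apply: nearW => q; rewrite ffunE.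
Qed.

Definition powSheaf : modSheaf X :=
  @ModSheaf k X (fun p => {ffun 'I_n -> N p} : lmodType _) pow_reg
    pow_etale pow_regD pow_regZ.

Section Tuple.
Variable u : 'I_n -> modMap M N.

Let tup p (x : M p) : powSheaf p := [ffun i => u i p x].

Fact tup_linear p : linear (@tup p).
Proof. by move=> a x y; apply/ffunP => i; rewrite !ffunE linearP. Qed.

Let tupL p : {linear M p -> powSheaf p} :=
  HB.pack (@tup p) (GRing.isLinear.Build _ _ _ *:%R (@tup p) (@tup_linear p)).

Fact tup_reg s p : ms_reg M s p -> ms_reg powSheaf (fun q => tupL q (s q)) p.
Proof.
move=> hs i; apply: (etale_ext (ms_etale N) (mm_reg (u i) hs)).
by apply: nearW => q; rewrite /= ffunE.
Qed.

Definition tupleMap : modMap M powSheaf := ModMap tup_reg.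

End Tuple.

Section Sum.
Variable v : 'I_n -> modMap N M.

Let sum p (x : powSheaf p) : M p := \sum_i v i p (x i).

Fact sum_linear p : linear (@sum p).
Proof.
move=> a x y; rewrite /sum scaler_sumr -big_split; apply: eq_bigr => i _ /=.
by rewrite !ffunE linearP.
Qed.

Let sumL p : {linear powSheaf p -> M p} :=
  HB.pack (@sum p) (GRing.isLinear.Build _ _ _ *:%R (@sum p) (@sum_linear p)).

Fact sum_reg s p : ms_reg powSheaf s p -> ms_reg M (fun q => sumL q (s q)) p.
Proof.
move=> hs; apply: (etale_ext (ms_etale M)
  (s := fun q => \sum_(i <- index_enum 'I_n) v i q (s q i))); last exact: nearW.
elim: (index_enum _) => [|i r IH].
  apply: (etale_ext (ms_etale M) (ms_reg0 M p)).
  by apply: nearW => q; rewrite big_nil.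
apply: (etale_ext (ms_etale M) (ms_regD (mm_reg (v i) (hs i)) IH)).
by apply: nearW => q; rewrite big_cons.
Qed.

Definition sumMap : modMap powSheaf M := ModMap sum_reg.

End Sum.
End Powers.

Record gradedAlg (k : comNzRingType) := GradedAlg {
  ga_ring :> comNzRingType;
  ga_const : {rmorphism k -> ga_ring};
  homog_elt : int -> ga_ring -> Prop;
  ga_hom0 : forall i, homog_elt i 0;
  ga_homB : forall i x y, homog_elt i x -> homog_elt i y -> homog_elt i (x - y);
  ga_homM : forall i j x y,
    homog_elt i x -> homog_elt j y -> homog_elt (i + j) (x * y);
  ga_homC : forall c, homog_elt 0 (ga_const c);
  ga_homneg : forall n x, homog_elt (Negz n) x -> x = 0;
  ga_dec : forall x, exists N (c : nat -> ga_ring),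
    (forall i, homog_elt (Posz i) (c i)) /\ x = \sum_(i < N) c i;
  ga_uniq : forall N (c : nat -> ga_ring),
    (forall i, homog_elt (Posz i) (c i)) -> \sum_(i < N) c i = 0 ->
    forall i, (i < N)%N -> c i = 0 }.
Arguments homog_elt {k} g i x : rename.
Arguments ga_const {k} g : rename.

Section GradedTheory.
Variables (k : comNzRingType) (A : gradedAlg k).

Lemma ga_hom1 : homog_elt A 0 1.
Proof. by rewrite -(rmorph1 (ga_const A)); apply: ga_homC. Qed.

Lemma ga_homN i x : homog_elt A i x -> homog_elt A i (- x).
Proof. by move=> h; rewrite -sub0r; apply: ga_homB h; apply: ga_hom0. Qed.

Lemma ga_homD i x y : homog_elt A i x -> homog_elt A i y -> homog_elt A i (x + y).
Proof. by move=> h g; rewrite -[y]opprK; apply: ga_homB h _; apply: ga_homN. Qed.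

(* The homogeneous prime ideals not containing the irrelevant ideal.          *)
Record projPt := ProjPt {
  inpt :> A -> Prop;
  pt0 : inpt 0;
  ptD : forall x y, inpt x -> inpt y -> inpt (x + y);
  ptM : forall a x, inpt x -> inpt (a * x);
  pt1 : ~ inpt 1;
  pt_prime : forall x y, inpt (x * y) -> inpt x \/ inpt y;
  pt_homog : forall N (c : nat -> A), (forall i, homog_elt A (Posz i) (c i)) ->
    inpt (\sum_(i < N) c i) -> forall i, (i < N)%N -> inpt (c i);
  pt_relevant : exists i x, homog_elt A (Posz i.+1) x /\ ~ inpt x }.

HB.instance Definition _ := gen_eqMixin projPt.
HB.instance Definition _ := gen_choiceMixin projPt.

(* The sets [D(f)], for [f] homogeneous, form a basis of the topology.        *)
Definition zariski_open (U : set projPt) := forall p, U p ->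
  exists i f, [/\ homog_elt A i f, ~ p f & forall q : projPt, ~ q f -> U q].

Fact zariski_openT : zariski_open setT.
Proof. by move=> p _; exists 0, 1; split=> //; [exact: ga_hom1|exact: pt1]. Qed.

Lemma ptMN (p : projPt) x y : ~ p x -> ~ p y -> ~ p (x * y).
Proof. by move=> hx hy /pt_prime[]. Qed.

Lemma ptMNl (p : projPt) x y : ~ p (x * y) -> ~ p x.
Proof. by move=> h hx; apply: h; rewrite mulrC; apply: ptM. Qed.

Lemma ptMNr (p : projPt) x y : ~ p (x * y) -> ~ p y.
Proof. by move=> h hx; apply: h; apply: ptM. Qed.

Fact zariski_openI (U V : set projPt) :
  zariski_open U -> zariski_open V -> zariski_open (U `&` V).
Proof.
move=> hU hV p [/hU[i [f [hf pf HU]]] /hV[j [g [hg pg HV]]]].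
exists (i + j), (f * g); split; [exact: ga_homM|exact: ptMN|].
by move=> q h; split; [apply: HU (ptMNl h)|apply: HV (ptMNr h)].
Qed.

Fact zariski_open_bigU (I : Type) (f : I -> set projPt) :
  (forall i, zariski_open (f i)) -> zariski_open (\bigcup_i f i).
Proof.
move=> hf p [i _ /hf[j [g [hg pg H]]]]; exists j, g; split=> // q h.
by exists i => //; apply: H.
Qed.

HB.instance Definition _ := isOpenTopological.Build projPt
  zariski_openT zariski_openI zariski_open_bigU.

Lemma zariski_near (p : projPt) (P : projPt -> Prop) : (\forall q \near p, P q) <->
  exists i f, [/\ homog_elt A i f, ~ p f & forall q : projPt, ~ q f -> P q].
Proof.
split.
  rewrite /prop_near1 nbhsE => -[U [oU Up] UP].
  have [i [f [hf pf H]]] : exists i f,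
    [/\ homog_elt A i f, ~ p f & forall q : projPt, ~ q f -> U q] := oU _ Up.
  by exists i, f; split=> // q /H/UP.
move=> [i [f [hf pf H]]]; rewrite /prop_near1 nbhsE.
have oD : zariski_open [set q : projPt | ~ q f] by move=> q hq; exists i, f.
by exists [set q : projPt | ~ q f].
Qed.

Lemma near_pt (p : projPt) (P : projPt -> Prop) :
  (forall q, P q) -> \forall q \near p, P q.
Proof. exact: filterE. Qed.

Lemma near_pt1 (p : projPt) (P Q : projPt -> Prop) : (forall q, P q -> Q q) ->
  (\forall q \near p, P q) -> \forall q \near p, Q q.
Proof. exact: filterS. Qed.

Lemma near_ptI (p : projPt) (P Q : projPt -> Prop) :
  (\forall q \near p, P q) -> (\forall q \near p, Q q) ->
  \forall q \near p, P q /\ Q q.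
Proof. exact: filterI. Qed.

Lemma near_nonzero i f (p : projPt) : homog_elt A i f -> ~ p f ->
  \forall q \near p, ~ (q : projPt) f.
Proof. by move=> hf pf; apply/zariski_near; exists i, f. Qed.

Section Stalks.
Variable p : projPt.

Definition hden (s : A) := (exists i, homog_elt A i s) /\ ~ p s.

Fact hden1 : hden 1. Proof. by split; [exists 0; apply: ga_hom1|apply: pt1]. Qed.
Fact hdenM s t : hden s -> hden t -> hden (s * t).
Proof.
move=> [[i hs] ps] [[j ht] qt]; split; last exact: ptMN.
by exists (i + j); apply: ga_homM.
Qed.
Fact hden0 : ~ hden 0. Proof. by case=> _; apply; apply: pt0. Qed.

Definition hmulset := Mulset hden1 hdenM hden0.

(* The localization of [A] at the homogeneous elements outside [p].           *)
Definition hloc := locring hmulset.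
Definition hfrac (a s : A) : hloc := frac hmulset a s.

(* The part of degree [m] of [hloc]: [A_(p)] for [m = 0], and the stalk at    *)
(* [p] of the sheaf associated with the shifted module [A(m)] in general.     *)
Definition hdeg (m : int) (x : hloc) := exists i s a,
  [/\ homog_elt A i s, homog_elt A (i + m) a, ~ p s & x = hfrac a s].

Lemma hdeg0 m : hdeg m 0.
Proof.
exists 0, 1, 0; split; [exact: ga_hom1|exact: ga_hom0|exact: pt1|by []].
Qed.

Lemma hdegB m x y : hdeg m x -> hdeg m y -> hdeg m (x - y).
Proof.
move=> [i [s [a [hs ha ps ->]]]] [j [t [b [ht hb pt ->]]]].
have ds : hden s by split=> //; exists i.
have dt : hden t by split=> //; exists j.
exists (i + j), (s * t), (a * t - b * s); split.
- exact: ga_homM.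
- apply: ga_homB; first by rewrite addrAC; apply: ga_homM.
  by rewrite [i + j]addrC addrAC; apply: ga_homM.
- exact: ptMN.
- by rewrite /hfrac oppfrac // addfrac // mulNr.
Qed.

Lemma hdegM m n x y : hdeg m x -> hdeg n y -> hdeg (m + n) (x * y).
Proof.
move=> [i [s [a [hs ha ps ->]]]] [j [t [b [ht hb pt ->]]]].
exists (i + j), (s * t), (a * b); split.
- exact: ga_homM.
- by rewrite addrACA; apply: ga_homM.
- exact: ptMN.
- by rewrite /hfrac mulfrac //; split=> //; [exists i|exists j].
Qed.

Lemma hdeg_frac i m s a : homog_elt A i s -> homog_elt A (i + m) a -> ~ p s ->
  hdeg m (hfrac a s).
Proof. by move=> *; exists i, s, a. Qed.

Lemma hdeg1 : hdeg 0 1.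
Proof.
exists 0, 1, 1; split; [exact: ga_hom1|rewrite addr0; exact: ga_hom1|exact: pt1|].
by [].
Qed.

Definition hlocal_pred : {pred hloc} := fun x => `[< hdeg 0 x >].

Fact hlocal_subring : subring_closed hlocal_pred.
Proof.
split; first by apply/asboolP; apply: hdeg1.
- by move=> x y /asboolP hx /asboolP hy; apply/asboolP; apply: hdegB.
- move=> x y /asboolP hx /asboolP hy; apply/asboolP.
  by rewrite -[X in hdeg X]addr0; apply: hdegM.
Qed.
HB.instance Definition _ :=
  GRing.isSubringClosed.Build hloc hlocal_pred hlocal_subring.

Record hlocal := HLocal { hl_val :> hloc; _ : hl_val \in hlocal_pred }.
HB.instance Definition _ := [isSub for hl_val].
HB.instance Definition _ := [Choice of hlocal by <:].
HB.instance Definition _ := [SubChoice_isSubComNzRing of hlocal by <:].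

Lemma hlocalP (x : hlocal) : hdeg 0 (val x).
Proof. exact/asboolP/(valP x). Qed.

Section Twist.
Variable m : int.

Definition htwist_pred : {pred hloc} := fun x => `[< hdeg m x >].

Fact htwist_zmod : zmod_closed htwist_pred.
Proof.
split; first by apply/asboolP; apply: hdeg0.
by move=> x y /asboolP hx /asboolP hy; apply/asboolP; apply: hdegB.
Qed.
HB.instance Definition _ := GRing.isZmodClosed.Build hloc htwist_pred htwist_zmod.

Record htwist := HTwist { ht_val :> hloc; _ : ht_val \in htwist_pred }.
HB.instance Definition _ := [isSub for ht_val].
HB.instance Definition _ := [Choice of htwist by <:].
HB.instance Definition _ := [SubChoice_isSubZmodule of htwist by <:].

Lemma htwistP (x : htwist) : hdeg m (val x).
Proof. exact/asboolP/(valP x). Qed.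

Fact htscale_subproof (a : hlocal) (x : htwist) : val a * val x \in htwist_pred.
Proof. by apply/asboolP; rewrite -[m]add0r; apply: hdegM (hlocalP a) (htwistP x). Qed.

Definition htscale a x := HTwist (htscale_subproof a x).

Fact htscaleA a b x : htscale a (htscale b x) = htscale (a * b) x.
Proof. by apply: val_inj; rewrite /= mulrA. Qed.
Fact htscale1 : left_id 1 htscale.
Proof. by move=> x; apply: val_inj; rewrite /= mul1r. Qed.
Fact htscaleDr : right_distributive htscale +%R.
Proof. by move=> a x y; apply: val_inj; rewrite /= mulrDr. Qed.
Fact htscaleDl x : {morph htscale^~ x : a b / a + b}.
Proof. by move=> a b; apply: val_inj; rewrite /= mulrDl. Qed.

HB.instance Definition _ := GRing.Zmodule_isLmodule.Build hlocal htwist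
  htscaleA htscale1 htscaleDr htscaleDl.

End Twist.
End Stalks.

Definition frac_reg (m : int) (s : forall q : projPt, hloc q) (p : projPt) :=
  exists i f a, [/\ homog_elt A i f, homog_elt A (i + m) a, ~ p f &
    \forall q \near p, s q = hfrac q a f].

Lemma frac_near m s p : frac_reg m s p -> \forall q \near p, frac_reg m s q.
Proof.
move=> [i [f [a [hf ha pf H]]]].
by apply: filterS2 (near_nonzero hf pf) (near_join H) => q qf h; exists i, f, a.
Qed.

Lemma frac_ext m s t p : frac_reg m s p -> (\forall q \near p, s q = t q) ->
  frac_reg m t p.
Proof.
move=> [i [f [a [hf ha pf H]]]] e; exists i, f, a; split=> //.
by apply: filterS2 H e => q <-.
Qed.

Lemma frac_germ m p x : hdeg (p := p) m x -> exists s,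
  [/\ frac_reg m s p, s p = x & \forall q \near p, hdeg m (s q)].
Proof.
move=> [i [f [a [hf ha pf ->]]]]; exists (fun q => hfrac q a f); split=> //.
  by exists i, f, a; split=> //; apply: near_pt.
by apply: filterS (near_nonzero hf pf) => q qf; exists i, f, a.
Qed.

Lemma frac_sep m s t p : frac_reg m s p -> frac_reg m t p -> s p = t p ->
  \forall q \near p, s q = t q.
Proof.
move=> [i [f [a [hf ha pf H]]]] [j [g [b [hg hb pg H']]]].
rewrite (nbhs_singleton H) (nbhs_singleton H').
have df : hden p f by split=> //; exists i.
have dg : hden p g by split=> //; exists j.
move/(frac_eq (T := hmulset p) _ _ df dg) => [u [[l hu] pu] e].
apply: filterS3 H H' (near_nonzero (ga_homM (ga_homM hf hg) hu)
  (ptMN (ptMN pf pg) pu)) => q -> -> h.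
have qu := ptMNr h; have qf := ptMNl (ptMNl h); have qg := ptMNr (ptMNl h).
apply/frac_eq; [by split=> //; exists i|by split=> //; exists j|].
by exists u => //; split=> //; exists l.
Qed.

Lemma frac_regB m s t p : frac_reg m s p -> frac_reg m t p ->
  frac_reg m (fun q => s q - t q) p.
Proof.
move=> [i [f [a [hf ha pf H]]]] [j [g [b [hg hb pg H']]]].
exists (i + j), (f * g), (a * g - b * f); split.
- exact: ga_homM.
- apply: ga_homB; first by rewrite addrAC; apply: ga_homM.
  by rewrite [i + j]addrC addrAC; apply: ga_homM.
- exact: ptMN.
- apply: filterS2 (filterI H H') (near_nonzero (ga_homM hf hg) (ptMN pf pg)).
  move=> q [-> ->] h; have qf := ptMNl h; have qg := ptMNr h.
  have df : hden q f by split=> //; exists i.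
  have dg : hden q g by split=> //; exists j.
  by rewrite /hfrac oppfrac // addfrac // mulNr.
Qed.

Lemma frac_regM m n s t p : frac_reg m s p -> frac_reg n t p ->
  frac_reg (m + n) (fun q => s q * t q) p.
Proof.
move=> [i [f [a [hf ha pf H]]]] [j [g [b [hg hb pg H']]]].
exists (i + j), (f * g), (a * b); split.
- exact: ga_homM.
- by rewrite addrACA; apply: ga_homM.
- exact: ptMN.
- apply: filterS2 (filterI H H') (near_nonzero (ga_homM hf hg) (ptMN pf pg)).
  move=> q [-> ->] h; have qf := ptMNl h; have qg := ptMNr h.
  by rewrite /hfrac mulfrac //; split=> //; [exists i|exists j].
Qed.

Lemma frac_regD m s t p : frac_reg m s p -> frac_reg m t p ->
  frac_reg m (fun q => s q + t q) p.
Proof.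
move=> hs ht; apply: frac_ext (frac_regB hs (frac_regB (frac_regB ht ht) ht)) _.
by apply: near_pt => q; rewrite subrr sub0r opprK.
Qed.

Lemma frac_reg_elt m a p : homog_elt A m a -> frac_reg m (fun q => hfrac q a 1) p.
Proof.
move=> ha; exists 0, 1, a.
by split; [exact: ga_hom1|rewrite add0r|exact: pt1|exact: near_pt].
Qed.

Definition hlocal_reg (s : forall q, hlocal q) p := frac_reg 0 (fun q => val (s q)) p.

Fact hlocal_etale : is_etale hlocal_reg.
Proof.
split.
- by move=> s p /frac_near.
- by move=> s t p hs e; apply: frac_ext hs _; apply: near_pt1 e => q ->.
- move=> p m; have [s [hs es H]] := frac_germ (hlocalP m).
  have e : \forall q \near p, s q = val (insubd (0 : hlocal q) (s q)).
    by apply: near_pt1 H => q h; rewrite insubdK //; apply/asboolP.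
  exists (fun q => insubd (0 : hlocal q) (s q)); first exact: frac_ext hs e.
  by apply: val_inj; rewrite -(nbhs_singleton e) es.
- move=> s t p hs ht e; apply: near_pt1 (frac_sep hs ht (congr1 val e)) => q.
  exact: val_inj.
Qed.

Fact hlocal_regB s t p : hlocal_reg s p -> hlocal_reg t p ->
  hlocal_reg (fun q => s q - t q) p.
Proof. exact: frac_regB. Qed.

Fact hlocal_regM s t p : hlocal_reg s p -> hlocal_reg t p ->
  hlocal_reg (fun q => s q * t q) p.
Proof. by move=> hs ht; apply: (frac_regM hs ht). Qed.

Fact hconst_subproof (p : projPt) (c : k) :
  hfrac p (ga_const A c) 1 \in @hlocal_pred p.
Proof.
apply/asboolP; apply: (@hdeg_frac p 0 0); [exact: ga_hom1| |exact: pt1].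
by rewrite addr0; apply: ga_homC.
Qed.

Let hconst0 (p : projPt) c : hlocal p := HLocal (hconst_subproof p c).

Fact hconst_zmod p : zmod_morphism (hconst0 p).
Proof.
move=> c d; apply: val_inj; rewrite /= /hfrac rmorphB.
by have h := hden1 p; rewrite oppfrac // addfrac // !mulr1.
Qed.

Fact hconst_monoid p : monoid_morphism (hconst0 p).
Proof.
split; first by apply: val_inj; rewrite /= rmorph1.
move=> c d; apply: val_inj; rewrite /= /hfrac rmorphM.
by have h := hden1 p; rewrite mulfrac // mulr1.
Qed.

Definition hconst p : {rmorphism k -> hlocal p} :=
  HB.pack (hconst0 p) (GRing.isZmodMorphism.Build k (hlocal p) (hconst0 p)
    (@hconst_zmod p)) (GRing.isMonoidMorphism.Build k (hlocal p) (hconst0 p)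
    (@hconst_monoid p)).

Fact hconst_reg c p : hlocal_reg (fun q => hconst q c) p.
Proof. exact/frac_reg_elt/ga_homC. Qed.

Definition Proj : ringedSpace k :=
  @RingedSpace k projPt (fun p => hlocal p : comNzRingType) hlocal_reg
    hlocal_etale hlocal_regB hlocal_regM hconst hconst_reg.

Definition htwist_reg m (s : forall q, htwist q m) p :=
  frac_reg m (fun q => val (s q)) p.

Fact htwist_etale m : is_etale (@htwist_reg m).
Proof.
split.
- by move=> s p /frac_near.
- by move=> s t p hs e; apply: frac_ext hs _; apply: near_pt1 e => q ->.
- move=> p x; have [s [hs es H]] := frac_germ (htwistP x).
  have e : \forall q \near p, s q = val (insubd (0 : htwist q m) (s q)).
    by apply: near_pt1 H => q h; rewrite insubdK //; apply/asboolP.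
  exists (fun q => insubd (0 : htwist q m) (s q)); first exact: frac_ext hs e.
  by apply: val_inj; rewrite -(nbhs_singleton e) es.
- move=> s t p hs ht e; apply: near_pt1 (frac_sep hs ht (congr1 val e)) => q.
  exact: val_inj.
Qed.

Fact htwist_regD m s t p : @htwist_reg m s p -> @htwist_reg m t p ->
  @htwist_reg m (fun q => s q + t q) p.
Proof. exact: frac_regD. Qed.

Fact htwist_regZ m (a : forall q, hlocal q) s p : hlocal_reg a p ->
  @htwist_reg m s p -> @htwist_reg m (fun q => a q *: s q) p.
Proof. by move=> ha hs; have := frac_regM ha hs; rewrite add0r. Qed.

(* The sheaf [O(m)] associated with the graded module [A(m)].                 *)
Definition twist (m : int) : modSheaf Proj :=
  @ModSheaf k Proj (fun p => htwist p m : lmodType (hlocal p)) (@htwist_reg m)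
    (@htwist_etale m) (@htwist_regD m) (@htwist_regZ m).

Section Mult.
Variables (m m' : int) (g : A).
Hypothesis hg : homog_elt A (m' - m) g.

Fact mult_subproof p (x : htwist p m) : hfrac p g 1 * val x \in @htwist_pred p m'.
Proof.
apply/asboolP; rewrite -[m'](subrK m); apply: hdegM (htwistP x).
by apply: (@hdeg_frac p 0); [exact: ga_hom1|rewrite add0r|exact: pt1].
Qed.

Let mult p (x : htwist p m) : htwist p m' := HTwist (mult_subproof x).

Fact mult_linear p : linear (@mult p).
Proof. by move=> a x y; apply: val_inj; rewrite /= mulrDr mulrCA. Qed.

Let multL (p : Proj) : {linear twist m p -> twist m' p} :=
  HB.pack (@mult p) (GRing.isLinear.Build _ _ _ *:%R (@mult p) (@mult_linear p)).

Fact mult_reg s p : ms_reg (twist m) s p ->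
  ms_reg (twist m') (fun q => multL q (s q)) p.
Proof.
move=> hs; have := frac_regM (frac_reg_elt p hg) hs.
by rewrite subrK.
Qed.

Definition multMap : modMap (twist m) (twist m') := ModMap mult_reg.

Lemma multMapE p (x : htwist p m) : val (multMap p x) = hfrac p g 1 * val x.
Proof. by []. Qed.

End Mult.
End GradedTheory.

Section LocMap.
Variables (A B : comNzRingType) (T : mulset A) (T' : mulset B).
Variable phi : {rmorphism A -> B}.
Hypothesis phiT : forall s, T s -> T' (phi s).

Definition locmap (x : locring T) : locring T' :=
  frac T' (phi (repr x).1) (phi (val (repr x).2)).

Lemma locmap_frac a s : T s -> locmap (frac T a s) = frac T' (phi a) (phi s).
Proof.
move=> hs; have := reprE (frac T a s).
have hd := denP (repr (frac T a s)).
rewrite {1}/frac -/(frac T a s) => /(frac_eq _ _ hs hd)[u hu e].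
apply/frac_eq; [exact: phiT|exact: phiT|].
by exists (phi u); [exact: phiT|rewrite -!rmorphM e].
Qed.

Fact locmap_zmod : zmod_morphism locmap.
Proof.
move=> x y; have [a [s [hs ->]]] := fracP x; have [b [t [ht ->]]] := fracP y.
have h := phiT hs; have h' := phiT ht; have h'' := inmsM hs ht.
rewrite oppfrac // addfrac // !locmap_frac // oppfrac // addfrac //.
by rewrite rmorphD !rmorphM rmorphN.
Qed.

Fact locmap_monoid : monoid_morphism locmap.
Proof.
split; first by rewrite locmap_frac ?rmorph1 //; apply: inms1.
move=> x y; have [a [s [hs ->]]] := fracP x; have [b [t [ht ->]]] := fracP y.
have h := phiT hs; have h' := phiT ht; have h'' := inmsM hs ht.
by rewrite mulfrac // !locmap_frac // mulfrac // !rmorphM.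
Qed.

End LocMap.

Section ProjMap.
Variables (k : comNzRingType) (A B : gradedAlg k) (phi : {rmorphism A -> B}).
Hypothesis phiC : forall c, phi (ga_const A c) = ga_const B c.
Hypothesis phi_hom : forall i x, homog_elt A i x -> homog_elt B i (phi x).
Hypothesis phi_surj : forall i y, homog_elt B i y ->
  exists2 x, homog_elt A i x & phi x = y.

Section Point.
Variable p : projPt B.
Let inp (x : A) := p (phi x).
Fact preim0 : inp 0. Proof. by rewrite /inp rmorph0; apply: pt0. Qed.
Fact preimD x y : inp x -> inp y -> inp (x + y).
Proof. by rewrite /inp rmorphD; apply: ptD. Qed.
Fact preimM a x : inp x -> inp (a * x).
Proof. by rewrite /inp rmorphM; apply: ptM. Qed.
Fact preim1 : ~ inp 1. Proof. by rewrite /inp rmorph1; apply: pt1. Qed.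
Fact preim_prime x y : inp (x * y) -> inp x \/ inp y.
Proof. by rewrite /inp rmorphM; apply: pt_prime. Qed.
Fact preim_homog N (c : nat -> A) : (forall i, homog_elt A (Posz i) (c i)) ->
  inp (\sum_(i < N) c i) -> forall i, (i < N)%N -> inp (c i).
Proof.
rewrite /inp => hc; rewrite rmorph_sum => h i iN.
by apply: (pt_homog (N := N) (c := fun i => phi (c i))) => // j; apply: phi_hom.
Qed.
Fact preim_relevant : exists i x, homog_elt A (Posz i.+1) x /\ ~ inp x.
Proof.
have [i [y [/phi_surj[x hx <-] py]]] := pt_relevant p.
by exists i, x.
Qed.

Definition projPt_preim : projPt A :=
  ProjPt preim0 preimD preimM preim1 preim_prime preim_homog preim_relevant.
End Point.

Local Notation f := (projPt_preim : Proj B -> Proj A).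

Fact projPt_preim_cont : continuous f.
Proof.
move=> p P /zariski_near[i [g [hg pg H]]]; apply/zariski_near.
exists i, (phi g); split; [exact: phi_hom|exact: pg|].
by move=> q qg; apply: (H (projPt_preim q)).
Qed.

Section Stalk.
Variable p : projPt B.

Fact hden_phi s : hden (projPt_preim p) s -> hden p (phi s).
Proof. by move=> [[i hs] ps]; split=> //; exists i; apply: phi_hom. Qed.

Let hm : hloc (projPt_preim p) -> hloc p :=
  @locmap _ _ (hmulset (projPt_preim p)) (hmulset p) phi.

Lemma hm_frac i a s : homog_elt A i s -> ~ p (phi s) ->
  hm (hfrac (projPt_preim p) a s) = hfrac p (phi a) (phi s).
Proof.
move=> hs ps; apply: locmap_frac; first exact: hden_phi.
by split=> //; exists i.
Qed.

Fact hm_subproof (x : hlocal (projPt_preim p)) : hm (val x) \in @hlocal_pred _ _ p.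
Proof.
apply/asboolP; have [i [s [a [hs ha ps ->]]]] := hlocalP x.
by exists i, (phi s), (phi a); rewrite (hm_frac _ hs) //; split=> //; apply: phi_hom.
Qed.

Let hmap (x : hlocal (projPt_preim p)) : hlocal p := HLocal (hm_subproof x).

Fact hmap_zmod : zmod_morphism hmap.
Proof.
move=> x y; apply: val_inj; apply: (locmap_zmod (T := hmulset _)).
exact: hden_phi.
Qed.

Fact hmap_monoid : monoid_morphism hmap.
Proof.
have [h1 hM] := @locmap_monoid _ _ (hmulset _) (hmulset p) phi hden_phi.
by split=> [|x y]; apply: val_inj; [apply: h1|apply: hM].
Qed.

Definition projMap_stalk : {rmorphism hlocal (projPt_preim p) -> hlocal p} :=
  HB.pack hmap (GRing.isZmodMorphism.Build _ _ hmap hmap_zmod)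
    (GRing.isMonoidMorphism.Build _ _ hmap hmap_monoid).

Lemma projMap_stalkE i a s (x : hlocal (projPt_preim p)) :
  homog_elt A i s -> ~ p (phi s) -> val x = hfrac (projPt_preim p) a s ->
  val (projMap_stalk x) = hfrac p (phi a) (phi s).
Proof. by move=> hs ps e; rewrite /= e (hm_frac _ hs). Qed.

End Stalk.

Fact projMap_const p c :
  projMap_stalk p (rs_const (Proj A) (f p) c) = rs_const (Proj B) p c.
Proof.
have p1 : ~ p (phi 1) by rewrite rmorph1; apply: pt1.
apply: val_inj; rewrite [LHS](projMap_stalkE (a := ga_const A c) (ga_hom1 A) p1) //.
by rewrite phiC rmorph1.
Qed.

Fact projMap_reg s p : rs_reg (Proj A) s (f p) ->
  rs_reg (Proj B) (fun q => projMap_stalk q (s (f q))) p.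
Proof.
move=> [i [g [a [hg ha pg H]]]]; exists i, (phi g), (phi a).
split; [exact: phi_hom|exact: phi_hom|exact: pg|].
have H' : \forall q \near (p : projPt B), val (s (f q)) = hfrac (f q) a g.
  exact: projPt_preim_cont H.
apply: near_pt1 (near_ptI H' (near_nonzero (phi_hom hg) pg)) => q [e qg].
exact: projMap_stalkE hg qg e.
Qed.

Definition projMap : ringedMap (Proj B) (Proj A) :=
  @RingedMap k (Proj B) (Proj A) f projPt_preim_cont projMap_stalk
    projMap_const projMap_reg.

End ProjMap.

Definition nat_grading (A : nmodType) (g : nat -> A -> Prop) (i : int) (x : A) :=
  if i is Posz d then g d x else x = 0.

Lemma nat_gradingM (A : comNzRingType) (g : nat -> A -> Prop) :
  (forall i, g i 0) ->
  (forall i j x y, g i x -> g j y -> g (i + j)%N (x * y)) ->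
  forall i j x y, nat_grading g i x -> nat_grading g j y ->
  nat_grading g (i + j) (x * y).
Proof.
move=> g0 gM i j x y.
have n0 l : nat_grading g l 0 by case: l => //=.
by case: i => i; case: j => j //= hx hy;
  rewrite ?hx ?hy ?mul0r ?mulr0 //; apply: gM.
Qed.

Section PolyRing.
Variables (k : comNzRingType) (n : nat).
Local Notation R := {mpoly k[n.+1]}.

Let hom (d : nat) (f : R) : Prop := f \is d.-homog.

Fact poly_hom0 i : nat_grading hom i 0.
Proof. by case: i => //= d; apply: dhomog0. Qed.

Fact poly_homB i x y : nat_grading hom i x -> nat_grading hom i y ->
  nat_grading hom i (x - y).
Proof. by case: i => [d|d] /=; [apply: rpredB|move=> -> ->; rewrite subr0]. Qed.

Fact poly_homM i j x y : nat_grading hom i x -> nat_grading hom j y ->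
  nat_grading hom (i + j) (x * y).
Proof.
apply: nat_gradingM => [d|d e u v]; [exact: dhomog0|exact: dhomogM].
Qed.

Fact poly_homC c : nat_grading hom 0 (mpolyC n.+1 c).
Proof. by rewrite /= /hom -alg_mpolyC; apply: rpredZ; apply: dhomog1. Qed.

Fact poly_dec (x : R) : exists N (c : nat -> R),
  (forall i, nat_grading hom (Posz i) (c i)) /\ x = \sum_(i < N) c i.
Proof.
exists (msize x), (fun i => pihomog mdeg i x); split=> [i|].
  exact: pihomogP.
exact: pihomog_partitionE.
Qed.

Lemma pihomog_sum N (c : nat -> R) : (forall i, c i \is i.-homog) ->
  forall i, (i < N)%N -> pihomog mdeg i (\sum_(j < N) c j) = c i.
Proof.
move=> hc i iN; rewrite raddf_sum (bigD1 (Ordinal iN)) //= big1 ?addr0.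
  exact: pihomog_dE.
move=> j ji; apply: (pihomog_ne0 (d := j)) (hc j).
by apply: contraNneq ji => e; apply/eqP/val_inj.
Qed.

Fact poly_uniq N (c : nat -> R) :
  (forall i, nat_grading hom (Posz i) (c i)) -> \sum_(i < N) c i = 0 ->
  forall i, (i < N)%N -> c i = 0.
Proof. by move=> hc e i iN; rewrite -(pihomog_sum hc iN) e raddf0. Qed.

Definition polyAlg : gradedAlg k :=
  @GradedAlg k R (@mpolyC n.+1 k) (nat_grading hom) poly_hom0 poly_homB poly_homM
    poly_homC (fun _ _ => id) poly_dec poly_uniq.

End PolyRing.

Definition projSpace (k : comNzRingType) (n : nat) := Proj (polyAlg k n).

Record hypersurface (k : fieldType) (n : nat) := Hypersurface {
  hs_deg : nat;
  hs_form : {mpoly k[n.+1]};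
  hs_deg2 : (2 <= hs_deg)%N;
  hs_homog : hs_form \is hs_deg.-homog;
  hs_x0 : hs_form@_(U_(ord0) *+ hs_deg)%MM = 1 }.

Section Hypersurface.
Variables (k : fieldType) (n : nat) (H : hypersurface k n).
Local Notation R := {mpoly k[n.+1]}.
Local Notation F := (hs_form H).
Local Notation d := (hs_deg H).

Definition form_ideal : {pred R} := fun f => `[< exists g, f = g * F >].

Fact form_ideal_closed : idealr_closed form_ideal.
Proof.
split; first by apply/asboolP; exists 0; rewrite mul0r.
  apply/asboolP => -[g /(congr1 (mcoeff 0%MM))].
  rewrite rmorphM rmorph1 /= [F@__](dhomog_nemf_coeff (hs_homog H)) ?mulr0.
    by move/eqP; rewrite oner_eq0.
  by rewrite /= mdeg0 eq_sym -lt0n; apply: leq_trans (hs_deg2 H).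
move=> a u v /asboolP[g ->] /asboolP[h ->]; apply/asboolP.
by exists (a * g + h); rewrite mulrDl mulrA.
Qed.

HB.instance Definition _ := isIdealr.Build R form_ideal form_ideal_closed.

Definition coordRing : comNzRingType := {ideal_quot form_ideal}.

Definition coordProj : {rmorphism R -> coordRing} := \pi_{ideal_quot form_ideal}.

Lemma coordProj_surj (y : coordRing) : exists x, coordProj x = y.
Proof. by exists (repr y); rewrite /= reprK. Qed.

Lemma coordProj_eq0 x : coordProj x = 0 <-> exists g, x = g * F.
Proof.
have -> : (coordProj x = 0) <-> (x \in form_ideal).
  rewrite -[x in x \in _]subr0 Quotient.idealrBE; split.
    by move=> e; apply/eqP; rewrite [LHS]e -[LHS](rmorph0 coordProj).
  by move/eqP => e; rewrite [LHS]e [LHS](rmorph0 coordProj).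
by split=> /asboolP.
Qed.

Let hom (m : nat) (y : coordRing) : Prop :=
  exists2 x : R, x \is m.-homog & coordProj x = y.

Fact coord_hom_nat0 m : hom m 0.
Proof. by exists 0; rewrite ?dhomog0 ?rmorph0. Qed.

Fact coord_hom0 i : nat_grading hom i 0.
Proof. by case: i => //= m; apply: coord_hom_nat0. Qed.

Fact coord_homB i x y : nat_grading hom i x -> nat_grading hom i y ->
  nat_grading hom i (x - y).
Proof.
case: i => [m|m] /=; last by move=> -> ->; rewrite subr0.
by move=> [f hf <-] [g hg <-]; exists (f - g); rewrite ?rmorphB ?rpredB.
Qed.

Fact coord_homM i j x y : nat_grading hom i x -> nat_grading hom j y ->
  nat_grading hom (i + j) (x * y).
Proof.
apply: nat_gradingM => [m|a b u v]; first exact: coord_hom_nat0.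
by move=> [f hf <-] [g hg <-]; exists (f * g); rewrite ?rmorphM // dhomogM.
Qed.

Definition coord_const : {rmorphism k -> coordRing} :=
  coordProj \o @mpolyC n.+1 k.

Fact coord_homC c : nat_grading hom 0 (coord_const c).
Proof. by exists (mpolyC n.+1 c) => //; apply: (poly_homC n c). Qed.

Fact coord_dec (y : coordRing) : exists N (c : nat -> coordRing),
  (forall i, nat_grading hom (Posz i) (c i)) /\ y = \sum_(i < N) c i.
Proof.
have [x <-] := coordProj_surj y; have [N [c [hc ->]]] := poly_dec x.
exists N, (fun i => coordProj (c i)); split; last by rewrite rmorph_sum.
by move=> i; exists (c i) => //; apply: hc.
Qed.

Lemma pihomog_ideal i g : exists h, pihomog mdeg i (g * F) = h * F.
Proof.
rewrite [g](pihomog_partitionE (leqnn (msize g))) mulr_suml raddf_sum /=.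
apply: (big_ind (fun z => exists h, z = h * F)).
- by exists 0; rewrite mul0r.
- by move=> _ _ [h ->] [h' ->]; exists (h + h'); rewrite mulrDl.
move=> j _; have hj := dhomogM (pihomogP mdeg j g) (hs_homog H).
have [<-|ne] := eqVneq (j + d)%N i; first by rewrite pihomog_dE //; eexists.
by exists 0; rewrite mul0r (pihomog_ne0 ne hj).
Qed.

Fact coord_uniq N (c : nat -> coordRing) :
  (forall i, nat_grading hom (Posz i) (c i)) -> \sum_(i < N) c i = 0 ->
  forall i, (i < N)%N -> c i = 0.
Proof.
move=> hc e i iN.
have /choice[b hb] : forall i, exists x : R, x \is i.-homog /\ coordProj x = c i.
  by move=> j; have [x] := hc j; exists x.
have /coordProj_eq0[g eg] : coordProj (\sum_(j < N) b j) = 0.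
  by rewrite rmorph_sum -[RHS]e; apply: eq_bigr => j _; apply: (hb j).2.
rewrite -(hb i).2; apply/coordProj_eq0.
have [h eh] := pihomog_ideal i g; exists h.
by rewrite -eh -eg pihomog_sum // => j; apply: (hb j).1.
Qed.

Definition coordAlg : gradedAlg k :=
  @GradedAlg k coordRing coord_const (nat_grading hom) coord_hom0 coord_homB
    coord_homM coord_homC (fun _ _ => id) coord_dec coord_uniq.

Definition hypScheme : ringedSpace k := Proj coordAlg.

Fact coordProj_hom i (x : R) : homog_elt (polyAlg k n) i x ->
  homog_elt coordAlg i (coordProj x).
Proof. by case: i => [m|m] /=; [exists x|move=> ->; rewrite rmorph0]. Qed.

Fact coordProj_hom_surj i (y : coordRing) : homog_elt coordAlg i y ->
  exists2 x : R, homog_elt (polyAlg k n) i x & coordProj x = y.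
Proof.
case: i => [m|m] /=; first by move=> [x]; exists x.
by move=> ->; exists 0; rewrite ?rmorph0.
Qed.

Definition hypImm : ringedMap hypScheme (projSpace k n) :=
  @projMap k (polyAlg k n) coordAlg coordProj (fun=> erefl) coordProj_hom
    coordProj_hom_surj.

Fact cotangent_dd p (x : conormal hypImm p) :
  zeroMap (pullback hypImm (Omega (projSpace k n))) (zeroSheaf hypScheme) p
    (conormalMap hypImm p x) = 0.
Proof. by []. Qed.

Definition cotangentComplex : complex hypScheme := cx3 cotangent_dd.

Lemma mderiv_homog i (f : R) m : f \is m.+1.-homog -> f^`M(i) \is m.-homog.
Proof.
move=> /dhomogP hf; rewrite /mderiv big_seq rpred_sum // => t ht.
have [t0|t0] := eqVneq (t i) 0%N; first by rewrite t0 mul0r scale0r dhomog0.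
rewrite rpredZ // dhomogX /=; have := hf _ ht; rewrite /=.
have /submK {1}<- : (U_(i) <= t)%MM by rewrite lep1mP.
by rewrite mdegD mdeg1 addn1 => -[->].
Qed.

Lemma euler (f : R) m : f \is m.-homog -> \sum_i 'X_i * f^`M(i) = m%:R * f.
Proof.
move=> /dhomogP hf; rewrite [in RHS](mpolyE f) /mderiv.
under eq_bigr do rewrite mulr_sumr.
rewrite exchange_big mulr_sumr /= !big_seq; apply: eq_bigr => t ht.
rewrite -(hf _ ht) /= mdegE natr_sum mulr_suml; apply: eq_bigr => i _.
have [t0|t0] := eqVneq (t i) 0%N; first by rewrite t0 !mul0r scale0r mulr0.
rewrite -scalerAr -mpolyXD addmC submK ?lep1mP // -scalerA.
by rewrite scaler_nat mulr_natl.
Qed.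

Fact partial_hom i : homog_elt coordAlg (- 1 - - d%:Z) (coordProj (F^`M(i))).
Proof.
have -> : - 1 - - d%:Z = d.-1%:Z :> int.
  by rewrite opprK addrC -[d in d%:Z](@prednK d) ?(ltnW (hs_deg2 H)) // -addn1 PoszD addrK.
exists (F^`M(i)) => //; apply: mderiv_homog.
by rewrite prednK ?(ltnW (hs_deg2 H)) // hs_homog.
Qed.

Fact coordX_hom i : homog_elt coordAlg (0 - - 1) (coordProj 'X_i).
Proof. by exists 'X_i => //; rewrite dhomogX /= mdeg1. Qed.

(* [dual_u] is [s |-> (s * dF/dx_i)_i] and [dual_v] is                        *)
(* [(s_i)_i |-> \sum_i x_i s_i].                                              *)
Definition dual_u : modMap (twist coordAlg (- d%:Z)) (powSheaf (twist coordAlg (- 1)) n.+1) :=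
  tupleMap (fun i => multMap (partial_hom i)).

Definition dual_v : modMap (powSheaf (twist coordAlg (- 1)) n.+1) (twist coordAlg 0) :=
  sumMap (fun i => multMap (coordX_hom i)).

Fact dual_vu p (x : twist coordAlg (- d%:Z) p) : dual_v p (dual_u p x) = 0.
Proof.
have h := hden1 (p : projPt coordAlg).
have fracS (r : seq 'I_n.+1) (g : 'I_n.+1 -> coordRing) :
    \sum_(i <- r) hfrac p (g i) 1 = hfrac p (\sum_(i <- r) g i) 1.
  elim: r => [|i r IH]; first by rewrite !big_nil.
  by rewrite !big_cons IH /hfrac addfrac // !mulr1.
apply: val_inj; rewrite [LHS](raddf_sum (\val : htwist p 0 -> hloc p)).
transitivity (\sum_i hfrac p (coordProj ('X_i * F^`M(i))) 1 * val x).
  apply: eq_bigr => i _; rewrite /= ffunE /= mulrA; congr (_ * _).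
  by rewrite /hfrac mulfrac // mulr1 rmorphM.
rewrite -mulr_suml fracS -rmorph_sum (euler (hs_homog H)).
have -> : coordProj (d%:R * F) = 0 by apply/coordProj_eq0; exists d%:R.
by rewrite mul0r.
Qed.

Definition dualComplex : complex hypScheme := cx3 dual_vu.
End Hypersurface.

(* Main.v *)
From HB Require Import structures.
From mathcomp Require Import all_boot all_order all_algebra.
From mathcomp Require Import ring boolp filter topology_structure.
From mathcomp Require Import mpoly.
Require Import Defs.

(** The cotangent complex is [I/I^2 -> i^* Omega], and the two sheaves in it
    are known explicitly. For a hypersurface of equation [F] and degree [d],
    division by [F] is an isomorphism from [I/I^2] onto [O(-d)]. The Euler
    sequence [0 -> Omega -> O(-1)^(n+1) -> O -> 0] of the projective space is
    exact, locally split, and hence stays exact on the hypersurface: the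
    gradient [da |-> (da/dx_i)_i] identifies [i^* Omega] with the kernel of
    [(s_i)_i |-> \sum_i x_i s_i], which is onto. By the Leibniz rule
    [d(gF) = g dF + F dg], and [F] vanishes on the hypersurface; so under these
    identifications the differential of the cotangent complex is [g |-> g dF],
    and the gradient together with the division by [F] is a map of complexes
    ([gradMap_conormal], [eulerMap_grad]). It is a quasi-isomorphism for formal
    reasons ([cx3_quasi_iso]): an isomorphism in degree -1, an isomorphism onto
    the kernel of the second differential in degree 0, and a second
    differential that is surjective.

    Everything is checked on stalks. At a point [p] some coordinate [x_j] is
    invertible. The Euler sequence is split there by
    [y |-> \sum_l x_j y_l (x) d(x_l/x_j)] ([gradMap_inv], [gradInv_grad]); that
    this inverts the gradient on all of [i^* Omega] follows from the fact that a
    derivation vanishing on the affine coordinates [x_l/x_j] is zero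
    ([derivation_zero]). The division by [F] is onto because every local section
    of [O(-d)] lifts to the ambient space, where it can be multiplied by [F].
    It is injective because a multiple [g F^2] is the product of
    [g x_j^d F] and [F/x_j^d], two elements of [I] ([formQuotMap_inj]). *)

Set Implicit Arguments.
Unset Strict Implicit.
Unset Printing Implicit Defensive.

Import Order.TTheory GRing.Theory.

Local Open Scope ring_scope.

(** * Maps out of sheaves given by generators and relations *)

Section PullPresMap.
Variables (k : comNzRingType) (Y Z : ringedSpace k) (f : ringedMap Y Z).
Variables (G : Z -> choiceType) (regG : (forall p, G p) -> Z -> Prop).
Variable rel0 : forall p, seq (rs_stalk Z p * G p) -> Prop.
Hypothesis etG : is_etale regG.
Hypothesis relS : forall p (r : seq (rs_stalk Z p * G p)), rel0 r ->
  exists L, [/\ lreg regG L p, leval L p = r & \forall q \near p, rel0 (leval L q)].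

Local Notation M := (presSheaf etG relS).
Local Notation gen p g :=
  (tens (rm_stalk f p) (presgen (@rel0 (f p)) g) : pullback f M p).

(** A presentation of [M] on [Z] presents its pullback on [Y]: the pullback is
    spanned by the [1 (x) g], for [g] a generator. Properties of elements of a
    pullback are reduced to these by this principle. *)
Lemma pullPres_ind p (P : pullback f M p -> Prop) : P 0 ->
  (forall b g, P (b *: gen p g)) -> (forall x y, P x -> P y -> P (x + y)) ->
  forall x, P x.
Proof.
move=> P0 Pg PD x; have [l ->] := lcombP x.
rewrite lcombS; elim: l => [|[b m] l IH]; rewrite ?big_nil ?big_cons //.
apply: (PD _ _ _ IH) => {l IH} /=.
have [r ->] := lcombP m; elim: r => [|[c g] r IH].
  suff -> : presgen (tensrel (rm_stalk f p) (M:=M (f p))) (lcomb _ [::]) = 0.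
    by rewrite scaler0.
  have := tensZ (rm_stalk f p) 0 (0 : M (f p)).
  by rewrite scaler0 rmorph0 scale0r => h; apply: etrans h.
have := tensD (rm_stalk f p) (c *: presgen (@rel0 (f p)) g) (lcomb _ r).
rewrite tensZ /tens => e.
have -> : lcomb (@rel0 (f p)) ((c, g) :: r) = c *: presgen (@rel0 (f p)) g + lcomb _ r.
  by rewrite -lcomb_scale -lcomb_cat /= mulr1.
by rewrite e scalerDr scalerA; apply: PD (Pg _ _) IH.
Qed.

Variables (N : modSheaf Y) (h : forall p : Y, G (f p) -> N p).
Hypothesis hrel : forall p (r : seq (rs_stalk Z (f p) * G (f p))), rel0 r ->
  \sum_(x <- r) rm_stalk f p x.1 *: h x.2 = 0.
Hypothesis hreg : forall u p, regG u (f p) -> ms_reg N (fun q => h (u (f q))) p.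

Let h1 p (x : M (f p)) : N p := presliftS (@hrel p) x.

Fact pullPresMap_rel p (r : seq (rs_stalk Y p * M (f p))) :
  tensrel (rm_stalk f p) r -> \sum_(x <- r) x.1 *: h1 x.2 = 0.
Proof.
case=> [m m'|a m]; rewrite !big_cons big_nil /= addr0 /h1 ?scale1r ?scaleN1r.
  by rewrite linearD addrACA !subrr addr0.
by rewrite linearZ /= scaleNr subrr.
Qed.

Fact pullPresMap_reg u p : invim_reg (f := f) (M := M) u p ->
  ms_reg N (fun q => h1 (u q)) p.
Proof.
move=> [m [L hL H] e]; apply: (etale_ext (ms_etale N)
  (s := fun q => \sum_(x <- L) rm_stalk f q (x.1 (f q)) *: h (x.2 (f q)))).
  elim: L hL {H} => [_|x L IH [hx gx /IH H]].
    apply: (etale_ext (ms_etale N) (ms_reg0 N p)).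
    by apply: nearW => q; rewrite big_nil.
  apply: (etale_ext (ms_etale N)
    (ms_regD (s := fun q => rm_stalk f q (x.1 (f q)) *: h (x.2 (f q))) _ H)).
    by apply: ms_regZ; [exact: rm_reg|exact: hreg].
  by apply: nearW => q; rewrite big_cons.
apply: filterS2 e (rm_near H) => q -> ->.
by rewrite /h1 presliftS_lcomb big_map.
Qed.

(** The map out of the pullback determined by the images [h g] of the
    [1 (x) g]. Both the gradient and the division by the equation of the
    hypersurface are obtained from it. *)
Definition pullPresMap : modMap (pullback f M) N :=
  presMap (invim_etale f M) (@pullback_spread _ _ _ f M)
    pullPresMap_rel pullPresMap_reg.

Lemma pullPresMapE p g : pullPresMap p (gen p g) = h g.
Proof. by rewrite [LHS]preslift_gen /h1 presliftS_gen. Qed.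

End PullPresMap.

Section QuotmodGenerators.
Variables (S : comNzRingType) (M : lmodType S) (E : M -> Prop).

Lemma quotgenD x y : presgen (quotrel E) (x + y) =
  presgen (quotrel E) x + presgen (quotrel E) y.
Proof.
have := presrel (quotrelD E x y).
rewrite !big_cons big_nil /= addr0 scale1r !scaleN1r -opprD.
by move/subr0_eq.
Qed.

Lemma quotgenZ a x : presgen (quotrel E) (a *: x) = a *: presgen (quotrel E) x.
Proof.
have := presrel (quotrelZ E a x).
rewrite !big_cons big_nil /= addr0 scale1r scaleNr.
by move/subr0_eq.
Qed.

Lemma quotgen0 x : E x -> presgen (quotrel E) x = 0.
Proof. by move=> /(@quotrel0 _ _ E)/presrel; rewrite big_seq1 scale1r. Qed.

End QuotmodGenerators.

Lemma tupleMapE k (X : ringedSpace k) (M N : modSheaf X) n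
  (u : 'I_n -> modMap M N) p (x : M p) i : tupleMap u p x i = u i p x.
Proof. by rewrite [LHS]ffunE. Qed.

Lemma sum_delta_affine (S : comNzRingType) (V : lmodType S) N (v : 'I_N -> V) l j r :
  v j = 0 -> \sum_i ((i == l)%:R - (i == j)%:R * r) *: v i = v l.
Proof.
move=> vj; rewrite (bigD1 l) //= eqxx big1 ?addr0 => [|i /negPf ->].
  case: eqP => [->|_]; first by rewrite vj scaler0.
  by rewrite mul0r subr0 scale1r.
case: eqP => [->|_]; first by rewrite vj scaler0.
by rewrite mul0r subr0 scale0r.
Qed.

(** * Fractions and their derivatives *)

Section LocalizedDerivation.
Variables (A : comNzRingType) (T : mulset A) (dl : {additive A -> A}).
Hypothesis dlM : forall a b, dl (a * b) = dl a * b + a * dl b.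

(** The quotient rule, on a chosen representative; [locder_frac] shows that the
    choice does not matter. *)
Definition locder (x : locring T) : locring T :=
  let a := (repr x).1 in let s := val (repr x).2 in
  frac T (dl a * s - a * dl s) (s * s).

Lemma locder_frac a s : T s ->
  locder (frac T a s) = frac T (dl a * s - a * dl s) (s * s).
Proof.
move=> hs; rewrite /locder; have := reprE (frac T a s).
have hd := denP (repr (frac T a s)).
move: (repr _).1 (val _) hd => b t ht /(frac_eq _ _ hs ht) [u hu e].
apply/frac_eq; [exact: inmsM|exact: inmsM|exists (u * u); first exact: inmsM].
have e0 : u * (a * t - b * s) = 0 by rewrite mulrBr e subrr.
(* Applying [dl] to [e0] produces the term [dl u * (a * t - b * s)], which one *)
(* more factor [u] kills. *)
have e1 : u * u * (dl a * t + a * dl t - (dl b * s + b * dl s)) = 0.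
  have := congr1 (fun x => u * dl x) e0.
  rewrite raddf0 mulr0 dlM raddfB /= !dlM mulrDr.
  have -> : u * (dl u * (a * t - b * s)) = dl u * (u * (a * t - b * s)) by ring.
  by rewrite e0 mulr0 add0r mulrA.
apply: subr0_eq; transitivity
 ((- (t * s) * (u * u * (dl a * t + a * dl t - (dl b * s + b * dl s))) +
  (u * dl t * s + u * t * dl s) * (u * (a * t - b * s)))); first by ring.
by rewrite e0 e1 !mulr0 addr0.
Qed.

Lemma locderB : zmod_morphism locder.
Proof.
move=> x y; have [a [s [hs ->]]] := fracP x; have [b [t [ht ->]]] := fracP y.
have hst := inmsM hs ht; have hss := inmsM hs hs; have htt := inmsM ht ht.
rewrite oppfrac // addfrac // !locder_frac // oppfrac // addfrac //.
apply: eq_frac; [exact: inmsM|exact: inmsM|].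
rewrite raddfD !dlM raddfN; ring.
Qed.

Lemma locderM x y : locder (x * y) = locder x * y + x * locder y.
Proof.
have [a [s [hs ->]]] := fracP x; have [b [t [ht ->]]] := fracP y.
have hst := inmsM hs ht; have hss := inmsM hs hs; have htt := inmsM ht ht.
have h1 := inmsM hss ht; have h2 := inmsM hs htt.
rewrite mulfrac // !locder_frac // !mulfrac // addfrac //.
apply: eq_frac; [exact: inmsM|exact: inmsM|].
rewrite !dlM; ring.
Qed.

End LocalizedDerivation.

Section LocMorphism.
Variables (A B : comNzRingType) (T : mulset A) (T' : mulset B).
Variable phi : {rmorphism A -> B}.
Hypothesis phiT : forall s, T s -> T' (phi s).

Let lm : locring T -> locring T' := locmap T' phi.

Definition locmap_morphism : {rmorphism locring T -> locring T'} :=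
  HB.pack lm
    (GRing.isZmodMorphism.Build (locring T) (locring T') lm (locmap_zmod phiT))
    (GRing.isMonoidMorphism.Build (locring T) (locring T') lm (locmap_monoid phiT)).

Lemma locmap_morphism_frac a s : T s ->
  locmap_morphism (frac T a s) = frac T' (phi a) (phi s).
Proof. exact: locmap_frac. Qed.

End LocMorphism.

Section GradedFractions.
Variables (k : comNzRingType) (A : gradedAlg k) (p : projPt A).

Lemma hden_hom i s : homog_elt A i s -> ~ p s -> hden p s.
Proof. by move=> hs ps; split=> //; exists i. Qed.

Lemma hlocal_frac i a s : homog_elt A i s -> homog_elt A i a -> ~ p s ->
  exists x : hlocal p, val x = hfrac p a s.
Proof.
move=> hs ha ps; have h : hfrac p a s \in @hlocal_pred _ _ p.
  by apply/asboolP; apply: (hdeg_frac hs) ps; rewrite addr0.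
by exists (HLocal h).
Qed.

Lemma htwist_hdeg m y : hdeg (p := p) m y -> exists x : htwist p m, val x = y.
Proof. by move=> /asboolP h; exists (HTwist h). Qed.

Lemma hlocal_hdeg y : hdeg (p := p) 0 y -> exists x : hlocal p, val x = y.
Proof. by move=> /asboolP h; exists (HLocal h). Qed.

Fact hfrac1_zmod : zmod_morphism (fun a => hfrac p a 1).
Proof.
move=> a b; have h := hden1 p; rewrite /= /hfrac oppfrac // addfrac //.
by rewrite !mulr1.
Qed.

Fact hfrac1_monoid : monoid_morphism (fun a => hfrac p a 1).
Proof.
by split=> // a b; have h := hden1 p; rewrite /= /hfrac mulfrac // mulr1.
Qed.

(** The canonical morphism [a |-> a / 1]. With it identities between fractions
    become identities in the commutative ring [hloc p]. *)
Definition hfrac1 : {rmorphism A -> hloc p} :=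
  HB.pack (fun a => hfrac p a 1)
    (GRing.isZmodMorphism.Build A (hloc p) (fun a => hfrac p a 1) hfrac1_zmod)
    (GRing.isMonoidMorphism.Build A (hloc p) (fun a => hfrac p a 1) hfrac1_monoid).

Lemma hfracE a s : hden p s -> hfrac p a s = hfrac1 a * hfrac p 1 s.
Proof.
move=> hs; have h1 := hden1 p.
by rewrite -[hfrac1 a]/(hfrac p a 1) /hfrac mulfrac // mulr1 mul1r.
Qed.

Lemma hfracK s : hden p s -> hfrac1 s * hfrac p 1 s = 1.
Proof.
move=> hs; have h1 := hden1 p; rewrite -[hfrac1 s]/(hfrac p s 1) /hfrac mulfrac //.
rewrite mulr1 mul1r -[1 in RHS]/(frac (hmulset p) 1 1); apply: eq_frac => //.
by rewrite mulr1 mul1r.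
Qed.

Lemma hfracVM s t : hden p s -> hden p t ->
  hfrac p 1 (s * t) = hfrac p 1 s * hfrac p 1 t.
Proof. by move=> hs ht; rewrite /hfrac mulfrac // mulr1. Qed.

Lemma hfrac1_hdeg m a : homog_elt A m a -> hdeg m (hfrac1 a).
Proof.
move=> ha; apply: (hdeg_frac (i := 0)); [exact: ga_hom1|by rewrite add0r|exact: pt1].
Qed.

Lemma hfracV_hdeg m s : homog_elt A m s -> ~ p s -> hdeg (- m) (hfrac p 1 s).
Proof. by move=> hs ps; apply: (hdeg_frac hs) ps; rewrite subrr; apply: ga_hom1. Qed.

Lemma frac_section i (a s : A) : homog_elt A i s ->
  homog_elt A i a -> ~ p s -> exists2 u : forall w : projPt A, hlocal w,
  rs_reg (Proj A) u p & \forall w \near p, hl_val (u w) = hfrac w a s.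
Proof.
move=> hs ha ps; pose u (w : projPt A) := insubd (0 : hlocal w) (hfrac w a s).
have E : \forall w \near p, hl_val (u w) = hfrac w a s.
  apply: filterS (near_nonzero hs ps) => w ws; rewrite -[LHS]/(val (u w)).
  rewrite insubdK //; apply/asboolP; apply: (hdeg_frac hs) ws.
  by rewrite addr0.
by exists u => //; exists i, s, a; split=> //; rewrite addr0.
Qed.

End GradedFractions.

(** * Fractions on a closed subscheme of Proj *)

(** The hypersurface enters only through the properties of the surjection
    [phi] from the coordinate ring [A] of the ambient space onto the coordinate
    ring [B] of the subscheme. *)
Section ClosedSubscheme.
Variables (k : comNzRingType) (A B : gradedAlg k) (phi : {rmorphism A -> B}).
Hypothesis phiC : forall c, phi (ga_const A c) = ga_const B c.
Hypothesis phi_hom : forall i x, homog_elt A i x -> homog_elt B i (phi x).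
Hypothesis phi_surj : forall i y, homog_elt B i y ->
  exists2 x, homog_elt A i x & phi x = y.

Local Notation f := (projMap phiC phi_hom phi_surj).
Local Notation pt p := (projPt_preim phi_hom phi_surj p).

Section Point.
Variable p : projPt B.

(** Restriction of homogeneous fractions to the subscheme. In degree 0 it is the
    map on stalks of structure sheaves; all degrees are needed to restrict the
    sections of the twists. *)
Definition restr : {rmorphism hloc (pt p) -> hloc p} :=
  locmap_morphism (T := hmulset (pt p)) (T' := hmulset p)
    (@hden_phi _ _ _ _ phi_hom phi_surj p).

Lemma restr_frac i (a s : A) : homog_elt A i s -> ~ p (phi s) ->
  restr (hfrac (pt p) a s) = hfrac p (phi a) (phi s).
Proof.
by move=> hs ps; apply: locmap_morphism_frac; apply: (hden_hom (p := pt p) hs ps).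
Qed.

Lemma restr_stalk (x : hlocal (pt p)) :
  hl_val (rm_stalk f p x : hlocal p) = restr (hl_val x).
Proof. by []. Qed.

Lemma restr_hdeg m x : hdeg (p := pt p) m x -> hdeg m (restr x).
Proof.
move=> [i [s [a [hs ha ps ->]]]]; rewrite (restr_frac _ hs) //.
by exists i, (phi s), (phi a); split=> //; apply: phi_hom.
Qed.

Lemma restr_hdeg_surj m y : hdeg (p := p) m y ->
  exists2 x, hdeg (p := pt p) m x & restr x = y.
Proof.
move=> [i [s [a [/phi_surj [s' hs <-] /phi_surj [a' ha <-] ps ->]]]].
exists (hfrac (pt p) a' s'); last exact: restr_frac hs _.
exact: hdeg_frac ha _.
Qed.

End Point.

Section PolyDerivation.
Variable dl : {additive A -> A}.
Hypothesis dlM : forall a b, dl (a * b) = dl a * b + a * dl b.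
Hypothesis dlC : forall c, dl (ga_const A c) = 0.
Hypothesis dl_hom : forall m a, homog_elt A m a -> homog_elt A (m - 1) (dl a).

Section Stalk.
Variable z : projPt A.

Definition hderiv : hloc z -> hloc z := locder (T := hmulset z) dl.

Lemma hderiv_frac j (a s : A) : homog_elt A j s -> ~ z s ->
  hderiv (hfrac z a s) = hfrac z (dl a * s - a * dl s) (s * s).
Proof. by move=> hs zs; apply: (locder_frac dlM); apply: hden_hom hs zs. Qed.

Lemma hderiv_num_hom j m (a s : A) : homog_elt A j s -> homog_elt A (j + m) a ->
  homog_elt A (j + j + (m - 1)) (dl a * s - a * dl s).
Proof.
move=> hs ha; have da := dl_hom ha; have ds := dl_hom hs.
apply: ga_homB.
  have -> : j + j + (m - 1) = (j + m - 1) + j by ring.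
  exact: ga_homM.
have -> : j + j + (m - 1) = (j + m) + (j - 1) by ring.
exact: ga_homM.
Qed.

Lemma hderiv_hdeg m x : hdeg (p := z) m x -> hdeg (m - 1) (hderiv x).
Proof.
move=> [j [s [a [hs ha zs ->]]]]; rewrite (hderiv_frac _ hs) //.
apply: (hdeg_frac (i := j + j)); [exact: ga_homM|exact: hderiv_num_hom|].
exact: ptMN.
Qed.

Lemma hderivM x y : hderiv (x * y) = hderiv x * y + x * hderiv y.
Proof. exact: (locderM (T := hmulset z) dlM). Qed.

Lemma hderivB x y : hderiv (x - y) = hderiv x - hderiv y.
Proof. exact: (locderB (T := hmulset z) dlM). Qed.

End Stalk.

Fact partial_subproof (p : projPt B) (x : hlocal (pt p)) :
  restr p (hderiv (hl_val x)) \in @htwist_pred _ _ p (-1).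
Proof. by apply/asboolP/restr_hdeg; apply: (hderiv_hdeg (hlocalP _)). Qed.

(** The derivation [a / s |-> (dl a * s - a * dl s) / s ^ 2] of the structure
    sheaf with values in [O(-1)], restricted to the subscheme. *)
Definition partial (p : projPt B) (x : hlocal (pt p)) : htwist p (-1) :=
  HTwist (partial_subproof x).

Lemma partialB p x y : partial (p := p) (x - y) = partial x - partial y.
Proof.
apply: val_inj; transitivity (restr p (hderiv (hl_val x - hl_val y))); first by [].
by rewrite hderivB rmorphB.
Qed.

Lemma partialD p x y : partial (p := p) (x + y) = partial x + partial y.
Proof.
have p0 : partial (p := p) 0 = 0 by rewrite -(subrr 0) partialB subrr.
by rewrite -[y]opprK partialB opprK -[- y]sub0r partialB p0 sub0r opprK.
Qed.

Lemma partialM p x y : partial (p := p) (x * y) =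
  (rm_stalk f p x : hlocal p) *: partial y +
  (rm_stalk f p y : hlocal p) *: partial x.
Proof.
apply: val_inj.
transitivity (restr p (hderiv (hl_val x * hl_val y))); first by [].
transitivity (restr p (hl_val x) * restr p (hderiv (hl_val y)) +
  restr p (hl_val y) * restr p (hderiv (hl_val x))); last by [].
rewrite hderivM rmorphD !rmorphM addrC; congr (_ + _); exact: mulrC.
Qed.

Lemma partialC p c : partial (p := p) (rs_const (Proj A) (f p) c) = 0.
Proof.
apply: val_inj; apply: etrans (rmorph0 (restr p)); congr (restr p _).
apply: etrans (hderiv_frac _ (ga_hom1 A) (pt1 (p := pt p))) _.
by rewrite dlC -(rmorph1 (ga_const A)) dlC mul0r mulr0 subr0 rmorph1 mulr1.
Qed.

Fact partial_rel p (r : seq (rs_stalk (Proj A) (f p) * rs_stalk (Proj A) (f p))) :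
  kaehlerrel (rs_const (Proj A) (f p)) r ->
  \sum_(x <- r) rm_stalk f p x.1 *: (partial x.2 : twist B (-1) p) = 0.
Proof.
case=> [a b|a b|c]; rewrite !big_cons big_nil addr0 /fst /snd ?rmorphN ?rmorph1
  ?scale1r ?scaleN1r ?scaleNr.
- by rewrite partialD addrACA !subrr addr0.
- by rewrite partialM addrACA !subrr addr0.
- exact: partialC.
Qed.

Fact partial_reg u p : rs_reg (Proj A) u (f p) ->
  ms_reg (twist B (-1)) (fun q => partial (u (f q))) p.
Proof.
move=> [j [s [a [hs ha ps E]]]].
exists (j + j), (phi (s * s)), (phi (dl a * s - a * dl s)).
have hss := ga_homM hs hs; split; [exact: phi_hom| | |].
- by apply: phi_hom; apply: (hderiv_num_hom (m := 0)).
- by rewrite rmorphM; apply: ptMN.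
have E' := rm_near (f := f) E.
have := near_nonzero (phi_hom hs) ps; apply: filterS2 E' => q e qs.
transitivity (restr q (hderiv (hfrac (pt q) a s))).
  exact: (congr1 (fun x => restr q (hderiv x)) e).
rewrite (hderiv_frac _ hs) // (restr_frac _ hss) //.
by rewrite rmorphM; apply: ptMN.
Qed.

Definition partialMap : modMap (pullback f (Omega (Proj A))) (twist B (-1)) :=
  pullPresMap (rs_etale (Proj A)) (@kaehler_spread k (Proj A)) partial_rel partial_reg.

Lemma partialMapE p x : partialMap p (pderiv (f := f) x) = partial x.
Proof.
exact: (pullPresMapE (rs_etale (Proj A)) (@kaehler_spread k (Proj A))
  partial_rel partial_reg).
Qed.

End PolyDerivation.

(** * The Euler sequence *)

Section Coordinates.
Variables (N : nat) (X : 'I_N -> A).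
Hypothesis X_hom : forall i, homog_elt A 1 (X i).
(* Every form is a polynomial in the [X l], as a graded induction principle. *)
Hypothesis X_gen : forall Q : nat -> A -> Prop, (forall m, Q m 0) ->
  (forall c, Q 0%N (ga_const A c)) ->
  (forall m a b, Q m a -> Q m b -> Q m (a + b)) ->
  (forall m l a, Q m a -> Q m.+1 (X l * a)) ->
  forall m a, homog_elt A (Posz m) a -> Q m a.

Lemma chart_exists (p : projPt B) : exists j, ~ p (phi (X j)).
Proof.
apply: contrapT => /forallNP h.
have [i [y [/phi_surj [a ha <-] pa]]] := pt_relevant p; apply: pa.
have := X_gen (Q := fun m a => (0 < m)%N -> p (phi a)) _ _ _ _ ha.
apply=> // [m|m b c hb hc m0|m l b hb _].
- by rewrite rmorph0 => _; apply: pt0.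
- by rewrite rmorphD; apply: ptD; [apply: hb|apply: hc].
- by rewrite rmorphM mulrC; apply: ptM; apply: contrapT; apply: h.
Qed.

Section Chart.
Variables (p : projPt B) (j : 'I_N).
Hypothesis pXj : ~ p (phi (X j)).

Fact chart_subproof l : hfrac (pt p) (X l) (X j) \in @hlocal_pred _ _ (pt p).
Proof.
apply/asboolP; have hl : homog_elt A (1 + 0) (X l) by rewrite addr0.
exact: (hdeg_frac (p := pt p) (X_hom j) hl pXj).
Qed.

Definition chart l : hlocal (pt p) := HLocal (chart_subproof l).

Section DerivationZero.
Variables (V : lmodType (hlocal p)) (D : hlocal (pt p) -> V).
Hypothesis D_D : forall x y, D (x + y) = D x + D y.
Hypothesis D_M : forall x y, D (x * y) =
  (rm_stalk f p x : hlocal p) *: D y + (rm_stalk f p y : hlocal p) *: D x.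
Hypothesis D_C : forall c, D (rs_const (Proj A) (f p) c) = 0.
Hypothesis D_chart : forall l, D (chart l) = 0.

Let hXj : hden (pt p) (X j) := hden_hom (p := pt p) (X_hom j) pXj.

Let hdX m : hden (pt p) (X j ^+ m).
Proof.
elim: m => [|m IH]; first exact: hden1.
by rewrite exprS; apply: hdenM IH; exact: hXj.
Qed.

(** The functions killed by [D] contain the constants and the coordinates
    [X l / X j], and they form a ring; so [D] kills [a / X j ^ m] for every form
    [a] of degree [m]. *)
Lemma derivation_zero_form m a : homog_elt A (Posz m) a ->
  exists2 x : hlocal (pt p), hl_val x = hfrac (pt p) a (X j ^+ m) & D x = 0.
Proof.
have D0 : D 0 = 0 by apply: (addIr (D 0)); rewrite -D_D !add0r.
apply: (X_gen (Q := fun m a => exists2 x : hlocal (pt p),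
  hl_val x = hfrac (pt p) a (X j ^+ m) & D x = 0)) => {m a}.
- move=> m; exists 0 => //; rewrite (hfracE 0 (hdX m)) rmorph0 mul0r; exact: erefl.
- by move=> c; exists (rs_const (Proj A) (f p) c) => //; rewrite expr0.
- move=> m a b [x ex Dx] [y ey Dy]; exists (x + y); last by rewrite D_D Dx Dy addr0.
  rewrite -[hl_val _]/(hl_val x + hl_val y) ex ey.
  rewrite (hfracE a (hdX m)) (hfracE b (hdX m)) (hfracE (a + b) (hdX m)).
  by rewrite rmorphD mulrDl.
- move=> m l a [x ex Dx]; exists (chart l * x); last first.
    by rewrite D_M Dx D_chart !scaler0 addr0.
  rewrite -[hl_val _]/(hl_val (chart l) * hl_val x) ex exprS.
  exact: (mulfrac (T := hmulset (pt p)) _ _ hXj (hdX m)).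
Qed.

(** A derivation is determined by its values on the affine coordinates of a
    chart: [x = a / s] satisfies [x * (s / X j ^ m) = a / X j ^ m], and
    [s / X j ^ m] is invertible. *)
Lemma derivation_zero x : D x = 0.
Proof.
have [i [s [a [hs ha ps ex]]]] := hlocalP x.
case: i hs ha => [m|m] hs; last by case: ps; rewrite (ga_homneg hs); apply: pt0.
rewrite addr0 => ha.
have [y ey Dy] := derivation_zero_form hs.
have [w ew Dw] := derivation_zero_form ha.
have hds : hden (pt p) s := hden_hom (p := pt p) hs ps.
have exy : x * y = w.
  apply: val_inj; rewrite -[LHS]/(hl_val x * hl_val y) -[RHS]/(hl_val w) ey ew.
  rewrite -[hl_val x]/(val x) ex /hfrac (mulfrac (T := hmulset (pt p)) _ _ hds (hdX m)).
  by apply: eq_frac; [exact: hdenM hds (hdX m)|exact: hdX|ring].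
have hXm : homog_elt A (Posz m) (X j ^+ m).
  elim: (m) => [|r IH]; first exact: ga_hom1.
  by rewrite exprS -add1n PoszD; apply: ga_homM.
have [t et] := hlocal_frac hs hXm ps.
have ety : t * y = 1.
  apply: val_inj; rewrite -[LHS]/(val t * hl_val y) et ey.
  rewrite (hfracE _ (hdX m)) (hfracE _ hds).
  by rewrite [X in _ * X]mulrC mulrACA (hfracK (hdX m)) mul1r mulrC (hfracK hds).
have : D (x * y) = 0 by rewrite exy.
rewrite D_M Dy scaler0 add0r => e.
have := congr1 (fun v => (rm_stalk f p t : hlocal p) *: v) e.
by rewrite scaler0 scalerA -rmorphM ety rmorph1 scale1r.
Qed.

End DerivationZero.
End Chart.

Section EulerSequence.
Variable dl : 'I_N -> {additive A -> A}.
Hypothesis dlM : forall i a b, dl i (a * b) = dl i a * b + a * dl i b.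
Hypothesis dlC : forall i c, dl i (ga_const A c) = 0.
Hypothesis dl_hom : forall i m a, homog_elt A m a -> homog_elt A (m - 1) (dl i a).
Hypothesis dlX : forall i l, dl i (X l) = (i == l)%:R.
Hypothesis phiX_hom : forall i, homog_elt B (0 - - 1) (phi (X i)).

Local Notation pd i := (partialMap (@dlM i) (@dlC i) (@dl_hom i)).

(** The gradient of functions, [1 (x) da |-> (dl i a)_i]. *)
Definition gradMap : modMap (pullback f (Omega (Proj A))) (powSheaf (twist B (-1)) N) :=
  tupleMap (fun i => pd i).

Definition eulerMap : modMap (powSheaf (twist B (-1)) N) (twist B 0) :=
  sumMap (fun i => multMap (phiX_hom i)).

(** Euler's identity: both sides are derivations that agree on the generators. *)
Lemma euler_form m a : homog_elt A (Posz m) a -> \sum_i X i * dl i a = a *+ m.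
Proof.
apply: (X_gen (Q := fun m a => \sum_i X i * dl i a = a *+ m)) => {m a}.
- by move=> m; rewrite mul0rn big1 // => i _; rewrite raddf0 mulr0.
- by move=> c; rewrite mulr0n big1 // => i _; rewrite dlC mulr0.
- move=> m a b ea eb; rewrite mulrnDl -ea -eb -big_split; apply: eq_bigr => i _.
  by rewrite raddfD mulrDr.
- move=> m l a ea; rewrite mulrS -mulrnAr -ea mulr_sumr.
  under eq_bigr do rewrite dlM dlX mulrDr mulrCA.
  rewrite big_split /= (bigD1 l) //= eqxx mul1r big1 ?addr0.
    by congr (_ + _); apply: eq_bigr => i _; rewrite mulrCA.
  by move=> i /negPf ->; rewrite mul0r.
Qed.

Lemma eulerMap_val p (y : powSheaf (twist B (-1)) N p) :
  ht_val (eulerMap p y : htwist p 0) =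
  \sum_i hfrac1 p (phi (X i)) * ht_val (y i : htwist p (-1)).
Proof. exact: (raddf_sum (\val : htwist p 0 -> hloc p)). Qed.

Lemma gradMap_pderiv p x i : gradMap p (pderiv (f := f) x) i =
  partial (@dlM i) (@dl_hom i) (p := p) x.
Proof. by rewrite [LHS]tupleMapE partialMapE. Qed.

Lemma pullOmega_ind p (Q : pullback f (Omega (Proj A)) p -> Prop) : Q 0 ->
  (forall b x, Q (b *: pderiv (f := f) x)) -> (forall x y, Q x -> Q y -> Q (x + y)) ->
  forall x, Q x.
Proof. exact: pullPres_ind. Qed.

(** Euler's identity in degree 0: in [\sum_i X i * (dl i a * s - a * dl i s)]
    the two parts are [m * a * s], where [m] is the common degree of [a] and
    [s], and cancel. *)
Lemma eulerMap_grad p w : eulerMap p (gradMap p w) = 0.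
Proof.
elim/pullOmega_ind: w => [|b x|x y ex ey]; first by rewrite !raddf0.
  rewrite linearZZ [eulerMap _ _]linearZZ.
  suff -> : eulerMap p (gradMap p (pderiv (f := f) x)) = 0 by rewrite scaler0.
  apply: val_inj; rewrite [LHS]eulerMap_val.
  have [i [s [a [hs ha ps ex]]]] := hlocalP x.
  case: i hs ha => [m|m] hs; last by case: ps; rewrite (ga_homneg hs); apply: pt0.
  rewrite addr0 => ha; have hss := ga_homM hs hs.
  have pss : ~ p (phi (s * s)) by rewrite rmorphM; apply: ptMN.
  transitivity (\sum_i hfrac1 p (phi (X i * (dl i a * s - a * dl i s))) *
      hfrac p 1 (phi (s * s))).
    apply: eq_bigr => i _; rewrite gradMap_pderiv.
    transitivity (hfrac1 p (phi (X i)) * restr p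
      (hderiv (dl i) (hfrac (pt p) a s))).
      by rewrite -ex.
    rewrite (hderiv_frac (@dlM i) _ hs) // (restr_frac _ hss) //.
    rewrite (hfracE _ (hden_hom (phi_hom hss) pss)) mulrA.
    by rewrite -rmorphM -rmorphM.
  rewrite -mulr_suml -!rmorph_sum.
  have -> : \sum_i X i * (dl i a * s - a * dl i s) = 0.
    have -> : \sum_i X i * (dl i a * s - a * dl i s) =
       (\sum_i X i * dl i a) * s - a * (\sum_i X i * dl i s).
      rewrite mulr_suml mulr_sumr -sumrB; apply: eq_bigr => i _; ring.
    by rewrite (euler_form ha) (euler_form hs) mulrnAl mulrnAr subrr.
  by rewrite !rmorph0 mul0r.
by rewrite (linearD (gradMap p)) (linearD (eulerMap p)) ex ey addr0.
Qed.

Section EulerChart.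
Variables (p : projPt B) (j : 'I_N).
Hypothesis pXj : ~ p (phi (X j)).

Local Notation x_ l := (chart pXj l).
Local Notation e_ l := (hfrac1 p (phi (X l))).
Local Notation w := (hfrac p 1 (phi (X j))).

Let hj : hden p (phi (X j)) := hden_hom (phi_hom (X_hom j)) pXj.

Lemma eulerMap_surj (y : htwist p 0) :
  exists x : powSheaf (twist B (-1)) N p, eulerMap p x = y.
Proof.
have [t et] : exists t : htwist p (-1), val t = w * ht_val y.
  apply: htwist_hdeg; rewrite -[-1]addr0.
  exact: hdegM (hfracV_hdeg (phi_hom (X_hom j)) pXj) (htwistP y).
exists [ffun i => if i == j then t else 0]; apply: val_inj.
rewrite [LHS]eulerMap_val (bigD1 j) //= ffunE eqxx big1 ?addr0.
  by rewrite -[ht_val t]/(val t) et mulrA hfracK // mul1r.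
by move=> i /negPf ij; rewrite ffunE ij mulr0.
Qed.

Fact mulX_subproof (y : htwist p (-1)) : e_ j * ht_val y \in @hlocal_pred _ _ p.
Proof.
apply/asboolP; rewrite -[0](subrr (1 : int)).
exact: hdegM (hfrac1_hdeg p (phi_hom (X_hom j))) (htwistP y).
Qed.

(** The trivialization of [O(-1)] on the chart. *)
Definition mulX (y : htwist p (-1)) : hlocal p := HLocal (mulX_subproof y).

Lemma mulXD y z : mulX (y + z) = mulX y + mulX z.
Proof. by apply: val_inj; rewrite /= mulrDr. Qed.

Lemma mulXZ a y : mulX (a *: y) = a * mulX y.
Proof. by apply: val_inj; rewrite /= mulrCA. Qed.

(** A retraction of the gradient on the chart where [X j] is invertible. The
    differentials [d(X l / X j)] with [l != j] are a basis there, and the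
    coefficient of the l-th one is read off the l-th component of the gradient,
    up to the factor [X j]. *)
Definition gradInv (y : powSheaf (twist B (-1)) N p) : pullback f (Omega (Proj A)) p :=
  \sum_l (mulX (y l) : rs_stalk (Proj B) p) *: pderiv (f := f) (x_ l).

Lemma gradInvD y z : gradInv (y + z) = gradInv y + gradInv z.
Proof.
rewrite /gradInv -big_split; apply: eq_bigr => l _.
by rewrite ffunE mulXD scalerDl.
Qed.

Lemma gradInvZ a y : gradInv (a *: y) = a *: gradInv y.
Proof.
rewrite /gradInv scaler_sumr; apply: eq_bigr => l _.
by rewrite ffunE mulXZ scalerA.
Qed.

Lemma gradInv0 : gradInv 0 = 0.
Proof. by rewrite -(scale0r (0 : powSheaf (twist B (-1)) N p)) gradInvZ scale0r. Qed.

(** The quotient rule for [d(X l / X j)]. *)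
Lemma partial_chart i l :
  ht_val (partial (@dlM i) (@dl_hom i) (p := p) (x_ l)) =
  ((i == l)%:R - (i == j)%:R * (e_ l * w)) * w.
Proof.
have hXX := ga_homM (X_hom j) (X_hom j).
have pXX : ~ p (phi (X j * X j)) by rewrite rmorphM; apply: ptMN.
transitivity (restr p (hderiv (dl i) (hfrac (pt p) (X l) (X j)))).
  by [].
rewrite (hderiv_frac (@dlM i) _ (X_hom j)) // (restr_frac _ hXX) //.
rewrite (hfracE _ (hden_hom (phi_hom hXX) pXX)) !dlX.
rewrite [phi (_ * _ - _)]rmorphB !rmorphM !rmorph_nat hfracVM //.
rewrite mulrBl rmorphB !rmorphM !rmorph_nat.
have := hfracK hj.
move: (e_ l) (e_ j) w (i == l)%:R (i == j)%:R => a b c u v e.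
by transitivity (u * (b * c) * c - v * (a * c) * c); [ring|rewrite e mulr1].
Qed.

(** By [partial_chart] the composite is [y i - (i == j) * (X j)^-1 * \sum_l X l * y l],
    and the sum vanishes. *)
Lemma gradMap_inv y : eulerMap p y = 0 -> gradMap p (gradInv y) = y.
Proof.
move=> /(congr1 (fun z : htwist p 0 => ht_val z)); rewrite eulerMap_val => ey.
apply/ffunP => i; rewrite [LHS]tupleMapE linear_sum; apply: val_inj.
rewrite [LHS](raddf_sum (\val : htwist p (-1) -> hloc p)).
transitivity (\sum_l (e_ j * ht_val (y l)) *
    (((i == l)%:R - (i == j)%:R * (e_ l * w)) * w)).
  by apply: eq_bigr => l _; rewrite linearZZ partialMapE -partial_chart.
transitivity (\sum_l ((i == l)%:R * ht_val (y l) -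
    (i == j)%:R * w * (e_ l * ht_val (y l)))).
  apply: eq_bigr => l _; have := hfracK hj.
  move: (e_ l) (e_ j) w (i == l)%:R (i == j)%:R (ht_val _) => a b c u v z e.
  transitivity ((b * c) * (u * z - v * c * (a * z))); first by ring.
  by rewrite e mul1r.
rewrite sumrB -mulr_sumr ey mulr0 subr0 (bigD1 i) //= eqxx mul1r big1 ?addr0 //.
by move=> l; rewrite eq_sym => /negPf ->; rewrite mul0r.
Qed.

Lemma pderivC c : pderiv (f := f) (p := p) (rs_const (Proj A) (f p) c) = 0.
Proof.
have := presrel (kaehlerC (rs_const (Proj A) (f p)) c).
rewrite big_seq1 scale1r => e; rewrite /pderiv /deriv e.
rewrite -(scale0r (0 : kaehler (rs_const (Proj A) (f p)))) tensZ rmorph0.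
exact: scale0r.
Qed.

(** The difference of the two sides is a derivation, so it suffices to compare
    them on the affine coordinates [X l / X j]; there the correction term of
    [partial_chart] is a multiple of [d(X j / X j) = 0]. *)
Lemma gradInv_grad v : gradInv (gradMap p v) = v.
Proof.
elim/pullOmega_ind: v => [|b x|x y ex ey]; last 1 first.
- by rewrite (linearD (gradMap p)) gradInvD ex ey.
- by rewrite raddf0 gradInv0.
rewrite linearZZ gradInvZ; congr (_ *: _).
apply: subr0_eq.
pose D (x : hlocal (pt p)) : (pullback f (Omega (Proj A)) p : lmodType (hlocal p)) :=
  gradInv (gradMap p (pderiv (f := f) x)) - pderiv (f := f) x.
have DD u v : D (u + v) = D u + D v.
  rewrite /D pderivD (linearD (gradMap p)) gradInvD opprD.
  exact: addrACA.
rewrite -[LHS]/(D x).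
refine (derivation_zero (pXj := pXj) _ _ _ _ x) => {x b}.
- exact: DD.
- move=> u v.
  rewrite /D pderivM (linearD (gradMap p)) gradInvD !linearZZ !gradInvZ.
  rewrite opprD addrACA; congr (_ + _); by rewrite scalerBr.
- by move=> c; rewrite /D pderivC raddf0 subr0 gradInv0.
move=> l; apply/eqP; rewrite subr_eq0; apply/eqP.
have rE : hl_val (rm_stalk f p (x_ l) : hlocal p) = e_ l * w.
  rewrite restr_stalk -(hfracE _ hj); exact: (restr_frac _ (X_hom j)).
have mE i : mulX (gradMap p (pderiv (f := f) (x_ l)) i) =
    (i == l)%:R - (i == j)%:R * rm_stalk f p (x_ l) :> hlocal p.
  apply: val_inj; rewrite gradMap_pderiv.
  transitivity (e_ j * (((i == l)%:R - (i == j)%:R * (e_ l * w)) * w)).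
    by rewrite -partial_chart.
  have := hfracK hj; rewrite -rE.
  transitivity ((i == l)%:R - (i == j)%:R * hl_val (rm_stalk f p (x_ l) : hlocal p)).
    rewrite mulrC -mulrA [w * _]mulrC; by rewrite hfracK // mulr1.
  by case: (i == l); case: (i == j); rewrite ?mul1r ?mul0r.
have p0 : pderiv (f := f) (x_ j) = 0.
  have h : hden (pt p) (X j) := hden_hom (p := pt p) (X_hom j) pXj.
  rewrite -(pderivC 1) rmorph1; congr pderiv; apply: val_inj.
  exact: etrans (hfracE _ h) (hfracK h).
rewrite /gradInv; under eq_bigr do rewrite mE.
exact: (sum_delta_affine (V := pullback f (Omega (Proj A)) p)).
Qed.

Lemma gradMap_inj v : gradMap p v = 0 -> v = 0.
Proof. by move=> v0; rewrite -[v]gradInv_grad v0 gradInv0. Qed.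

End EulerChart.
End EulerSequence.
End Coordinates.

(** * The conormal sheaf of a hypersurface *)

Section Conormal.
Variables (F : A) (d : nat).
Hypothesis F_hom : homog_elt A (Posz d) F.
Hypothesis F_reg : forall a, a * F = 0 -> a = 0.
Hypothesis phiF : phi F = 0.
Hypothesis phi_ker : forall e a, homog_elt A e a -> phi a = 0 ->
  exists2 g, homog_elt A (e - d%:Z) g & a = g * F.

Section Point.
Variable p : projPt B.
Local Notation z := (pt p).
Local Notation F1 := (hfrac1 z F).

Lemma form_reg (g h : hloc z) : g * F1 = h * F1 -> g = h.
Proof.
move=> e; apply: subr0_eq; have : (g - h) * F1 = 0 by rewrite mulrBl e subrr.
move: (g - h) => {e h} {}g.
have [a [s [hs ->]]] := fracP g; have h1 := hden1 z.
rewrite -[F1]/(frac (hmulset z) F 1) mulfrac // -[0]/(frac (hmulset z) 0 1).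
move=> /(frac_eq (T := hmulset z)) []; [exact: hdenM|exact: h1|].
move=> u hu; rewrite mul0r mulr0 !mulr1 mulrA => /F_reg ua.
by apply/frac_eq => //; exists u => //; rewrite mul0r mulr1 mulr0.
Qed.

Lemma restr_form : restr p F1 = 0.
Proof.
have p1 : ~ p (phi 1) by rewrite rmorph1; apply: pt1.
rewrite -[F1]/(hfrac z F 1) (restr_frac _ (ga_hom1 A) p1) phiF.
rewrite rmorph1; exact: rmorph0 (hfrac1 p).
Qed.

(** A fraction [a / s] vanishing on the hypersurface is divisible by [F]: some
    form [u] invertible at [p] makes [u * a] a multiple [b * F] of [F]. The forms
    [u] and [b] are exhibited because they serve at all points near [p] too,
    which is what regularity of the quotient requires. *)
Lemma restr_frac_eq0 i m (a s : A) : homog_elt A i s ->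
  homog_elt A (i + m) a -> ~ p (phi s) ->
  restr p (hfrac z a s) = 0 -> exists j u b,
  [/\ homog_elt A j u, ~ p (phi u),
      homog_elt A (j + i + (m - d%:Z)) b & u * a = b * F].
Proof.
move=> hs ha ps; rewrite (restr_frac _ hs) //.
have h1 := hden1 p; have hps := hden_hom (phi_hom hs) ps.
rewrite -[0]/(frac (hmulset p) 0 1).
move=> /(frac_eq (T := hmulset p) _ _ hps h1) [v [[j /phi_surj[u hu <-]] pu]].
rewrite mul0r mulr0 mulr1 -rmorphM => /(phi_ker (ga_homM hu ha)) [g hg eg].
by exists j, u, g; split=> //; move: hg; rewrite !addrA.
Qed.

Lemma frac_mul_form i j (a b s u : A) : homog_elt A i s ->
  ~ p (phi s) -> homog_elt A j u -> ~ p (phi u) ->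
  u * a = b * F -> hfrac z a s = hfrac z b (u * s) * F1.
Proof.
move=> hs ps hu pu e.
have hu' : hmulset z u := hden_hom (p := z) hu pu.
have hs' : hmulset z s := hden_hom (p := z) hs ps.
have h1 : hmulset z 1 := hden1 _; have hus := inmsM hu' hs'.
rewrite -[F1]/(hfrac z F 1) /hfrac mulfrac //; apply: eq_frac => //.
  exact: inmsM.
by rewrite -e mulr1; ring.
Qed.

Lemma restr_eq0 m x : hdeg (p := z) m x -> restr p x = 0 ->
  exists2 g, hdeg (p := z) (m - d%:Z) g & x = g * F1.
Proof.
move=> [i [s [a [hs ha ps ->]]]] /(restr_frac_eq0 hs ha ps).
move=> [j [u [b [hu pu hb e]]]].
exists (hfrac z b (u * s)); last exact: (frac_mul_form hs ps hu pu e).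
apply: (hdeg_frac (i := j + i)); [exact: ga_homM hu hs|exact: hb|].
by move=> /= h0; apply: (ptMN pu ps); rewrite -rmorphM.
Qed.

Lemma ideal_dvd (x : ideal_stalk f (f p)) : exists g : hloc z,
  hdeg (- d%:Z) g /\ hl_val (ideal_val x : hlocal z) = g * F1.
Proof.
have e0 : restr p (hl_val (ideal_val x : hlocal z)) = 0.
  by have := congr1 (fun y : hlocal p => hl_val y) (ideal_vanish x).
have [g hg eg] := restr_eq0 (hlocalP _) e0.
by exists g; split=> //; rewrite -[- _]add0r.
Qed.

(** The fraction [x / F], unique since [F] is regular. *)
Definition ideal_quot (x : ideal_stalk f (f p)) : hloc z := projT1 (cid (ideal_dvd x)).

Lemma ideal_quot_hdeg (x : ideal_stalk f (f p)) : hdeg (- d%:Z) (ideal_quot x).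
Proof. by rewrite /ideal_quot; case: cid => g []. Qed.

Lemma ideal_quotK (x : ideal_stalk f (f p)) :
  hl_val (ideal_val x : hlocal z) = ideal_quot x * F1.
Proof. by rewrite /ideal_quot; case: cid => g []. Qed.

Lemma ideal_quotE (x : ideal_stalk f (f p)) g :
  hl_val (ideal_val x : hlocal z) = g * F1 -> ideal_quot x = g.
Proof. by rewrite ideal_quotK => /form_reg. Qed.

Lemma ideal_quotD x y : ideal_quot (x + y) = ideal_quot x + ideal_quot y.
Proof. by apply: ideal_quotE; rewrite mulrDl -!ideal_quotK. Qed.

Lemma ideal_quotZ (a : hlocal z) x :
  ideal_quot ((a : rs_stalk (Proj A) (f p)) *: x) = hl_val a * ideal_quot x.
Proof. by apply: ideal_quotE; rewrite -mulrA -!ideal_quotK. Qed.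

Fact formQuot_subproof x : restr p (ideal_quot x) \in @htwist_pred _ _ p (- d%:Z).
Proof. by apply/asboolP/restr_hdeg/ideal_quot_hdeg. Qed.

Definition formQuot (x : ideal_stalk f (f p)) : htwist p (- d%:Z) :=
  HTwist (formQuot_subproof x).

Lemma formQuotD x y : formQuot (x + y) = formQuot x + formQuot y.
Proof.
apply: val_inj; transitivity (restr p (ideal_quot x + ideal_quot y)).
  by rewrite -ideal_quotD.
by rewrite rmorphD.
Qed.

Lemma formQuotZ (a : hlocal z) x :
  formQuot ((a : rs_stalk (Proj A) (f p)) *: x) = (rm_stalk f p a : hlocal p) *: formQuot x.
Proof.
apply: val_inj; transitivity (restr p (hl_val a * ideal_quot x)).
  by rewrite -ideal_quotZ.
by rewrite rmorphM.
Qed.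

Fact formQuot_rel (r : seq (rs_stalk (Proj A) (f p) * idealSheaf f (f p))) :
  quotrel (@ideal_prod _ _ _ f (f p)) r ->
  \sum_(x <- r) rm_stalk f p x.1 *: (formQuot x.2 : twist B (- d%:Z) p) = 0.
Proof.
case=> [m m'|a m|e [x [y ->]]]; rewrite !big_cons big_nil /fst /snd addr0
  ?rmorphN ?rmorph1 ?scale1r ?scaleN1r ?scaleNr.
- by rewrite formQuotD addrACA !subrr addr0.
- by rewrite formQuotZ subrr.
- by rewrite formQuotZ ideal_vanish scale0r.
Qed.

End Point.

Fact formQuot_reg u p : ms_reg (idealSheaf f) u (f p) ->
  ms_reg (twist B (- d%:Z)) (fun q => formQuot (u (f q))) p.
Proof.
move=> [i [s [a [hs ha ps E]]]].
have e0 : restr p (hfrac (pt p) a s) = 0.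
  rewrite -[hfrac _ _ _](nbhs_singleton E).
  by have := congr1 (fun y : hlocal p => hl_val y) (ideal_vanish (u (f p))).
have [j [v [b [hv pv hb e]]]] := restr_frac_eq0 hs ha ps e0.
have hvs := ga_homM hv hs.
exists (j + i), (phi (v * s)), (phi b); split; [exact: phi_hom| | |].
- by apply: phi_hom; move: hb; rewrite sub0r.
- by rewrite rmorphM; apply: ptMN.
apply: filterS3 (near_nonzero (phi_hom hs) ps) (near_nonzero (phi_hom hv) pv)
  (rm_near (f := f) E) => q qs qv eq.
have qvs : ~ q (phi (v * s)) by rewrite rmorphM; apply: ptMN.
rewrite -(restr_frac b hvs qvs).
apply: (congr1 (restr q)); apply: ideal_quotE.
by rewrite -(frac_mul_form hs qs hv qv e) -eq.
Qed.

(** The isomorphism from [I / I^2] to [O(-d)] that sends the class of [g * F] to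
    the restriction of [g]. *)
Definition formQuotMap : modMap (conormal f) (twist B (- d%:Z)) :=
  pullPresMap (f := f) (ms_etale (idealSheaf f))
    (quot_spread (@ideal_prod_spread _ _ _ f)) formQuot_rel formQuot_reg.

Local Notation cgen p x := (tens (rm_stalk f p)
  (presgen (quotrel (@ideal_prod _ _ _ f (f p))) x) : conormal f p).

Lemma formQuotMapE p x : formQuotMap p (cgen p x) = formQuot x.
Proof.
exact: (pullPresMapE (f := f) (ms_etale (idealSheaf f))
    (quot_spread (@ideal_prod_spread _ _ _ f)) formQuot_rel formQuot_reg).
Qed.

(** Scalars lift along the surjection from the local ring of the ambient space,
    so sums of tensors collapse to one class. *)
Lemma conormal_gen p (c : conormal f p) : exists x, c = cgen p x.
Proof.
have gen b x : exists y, b *: cgen p x = cgen p y.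
  have [g hg eg] := restr_hdeg_surj (hlocalP (b : hlocal p)).
  have [a ea] := hlocal_hdeg hg.
  exists ((a : rs_stalk (Proj A) (f p)) *: x).
  rewrite quotgenZ tensZ; congr (_ *: _); apply: val_inj.
  by rewrite [RHS]restr_stalk -[hl_val a]/(val a) ea eg.
apply: (pullPres_ind (P := fun c => exists x, c = cgen p x)) c => //.
  by have [y ey] := gen 0 0; exists y; rewrite -ey scale0r.
by move=> _ _ [x ->] [y ->]; exists (x + y); rewrite quotgenD tensD.
Qed.

(** A local section [a / s] of [O(-d)] gives the section [a * F / s] of the
    structure sheaf, defined and vanishing on the hypersurface wherever [s] is
    invertible. *)
Lemma ideal_of_quot p g : hdeg (p := pt p) (- d%:Z) g ->
  exists x : ideal_stalk f (f p), ideal_quot x = g.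
Proof.
move=> [i [s [a [hs ha ps ->]]]].
have haF : homog_elt A i (a * F).
  by rewrite -[i](subrK (d%:Z)); apply: ga_homM.
have [u hu E] := frac_section hs haF ps.
have ux : inker f (u (f p)).
  exists u; split=> //.
  apply: filterS2 E (near_nonzero hs ps) => w ew ws y yw.
  case: _ / yw ew ws => ew ws; apply: val_inj.
  rewrite [LHS]restr_stalk ew (restr_frac _ hs) // rmorphM phiF mulr0.
  by rewrite (hfracE _ (hden_hom (phi_hom hs) ws)) rmorph0 mul0r.
have /asboolP ux' := ux.
exists (IdealStalk ux'); apply: ideal_quotE => /=.
rewrite (nbhs_singleton E) (hfracE (a * F)) ?rmorphM; last first.
  exact: (hden_hom (p := pt p) hs ps).
rewrite (hfracE a); last exact: (hden_hom (p := pt p) hs ps).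
by rewrite mulrAC.
Qed.

Lemma formQuotMap_surj p (y : htwist p (- d%:Z)) : exists c, formQuotMap p c = y.
Proof.
have [g hg eg] := restr_hdeg_surj (htwistP y).
have [x ex] := ideal_of_quot hg; exists (cgen p x); rewrite formQuotMapE.
by apply: val_inj; rewrite -eg -ex.
Qed.

(** If the restriction of [x / F] vanishes then [x = g * F ^ 2]. To write [x] as a
    product of two elements of the ideal, the degrees are balanced by a form
    [h] of degree [d] invertible at [p]: [x = (g * h * F) * (F / h)]. *)
Lemma formQuotMap_inj (p : projPt B) h (c : conormal f p) :
  homog_elt A (Posz d) h -> ~ p (phi h) ->
  formQuotMap p c = 0 -> c = 0.
Proof.
move=> hh ph; have [x ->] := conormal_gen c; rewrite formQuotMapE => e.
have hd : hden (pt p) h := hden_hom (p := pt p) hh ph.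
have e0 : restr p (ideal_quot x) = 0.
  exact: (congr1 (fun y : htwist p (- d%:Z) => ht_val y) e).
have [g hg eg] := restr_eq0 (ideal_quot_hdeg x) e0.
have hgh : hdeg (p := pt p) (- d%:Z) (g * hfrac1 (pt p) h).
  by rewrite -[- d%:Z](subrK d%:Z); apply: hdegM hg (hfrac1_hdeg _ hh).
have [y ey] := ideal_of_quot hgh.
have [t et] := ideal_of_quot (hfracV_hdeg hh (ph : ~ (pt p) h)).
suff xyt : ideal_prod x.
  by rewrite (quotgen0 xyt) -(scale0r (0 : idealQuot f (f p))) tensZ rmorph0 scale0r.
exists y, t; apply: val_inj; apply: val_inj.
rewrite -[LHS]/(hl_val (ideal_val x : hlocal (pt p))).
rewrite -[RHS]/(hl_val (ideal_val y : hlocal (pt p)) *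
  hl_val (ideal_val t : hlocal (pt p))).
rewrite !ideal_quotK eg ey et; have := hfracK hd.
move: (hfrac1 _ h) (hfrac1 _ F) (hfrac _ 1 h) => a b c' ac.
by transitivity (g * b * (a * c') * b); [rewrite ac mulr1|ring].
Qed.

Variables (N : nat) (dl : 'I_N -> {additive A -> A}).
Hypothesis dlM : forall i a b, dl i (a * b) = dl i a * b + a * dl i b.
Hypothesis dlC : forall i c, dl i (ga_const A c) = 0.
Hypothesis dl_hom : forall i m a, homog_elt A m a -> homog_elt A (m - 1) (dl i a).
Hypothesis dF_hom : forall i, homog_elt B (- 1 - - d%:Z) (phi (dl i F)).

Lemma hderiv_form i z : hderiv (dl i) (hfrac1 z F) = hfrac1 z (dl i F).
Proof.
rewrite -[hfrac1 z F]/(hfrac z F 1) (hderiv_frac (@dlM i) _ (ga_hom1 A)); last exact: pt1.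
by rewrite -(rmorph1 (ga_const A)) dlC rmorph1 mulr0 subr0 !mulr1.
Qed.

(** Leibniz: [d(g * F) = g * dF + F * dg], and [F] vanishes on the hypersurface. *)
Lemma gradMap_conormal p (c : conormal f p) :
  gradMap dlM dlC dl_hom p (conormalMap f p c) =
  tupleMap (fun i => multMap (dF_hom i)) p
    (formQuotMap p c).
Proof.
have [x ->] := conormal_gen c.
rewrite conormalMapE formQuotMapE; apply/ffunP => i.
rewrite gradMap_pderiv [RHS]tupleMapE; apply: val_inj.
rewrite [RHS]multMapE.
transitivity (restr p (hderiv (dl i) (hl_val (ideal_val x : hlocal (pt p))))).
  by [].
rewrite ideal_quotK (hderivM (@dlM i)) hderiv_form rmorphD !rmorphM.
rewrite restr_form mulr0 add0r mulrC; congr (_ * _).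
have p1 : ~ p (phi 1) by rewrite rmorph1; apply: pt1.
rewrite -[hfrac1 _ _]/(hfrac (pt p) (dl i F) 1).
by rewrite (restr_frac _ (ga_hom1 A) p1) rmorph1.
Qed.

End Conormal.
End ClosedSubscheme.

(** * Quasi-isomorphisms onto a three-term complex *)

Section ThreeTermQuasiIso.
Variables (k : comNzRingType) (X : ringedSpace k) (A B A' B' C' : modSheaf X).
Variables (u : modMap A B) (u' : modMap A' B') (v' : modMap B' C').
Local Notation v := (zeroMap B (zeroSheaf X)).
Hypothesis vu : forall p (x : A p), v p (u p x) = 0.
Hypothesis vu' : forall p (x : A' p), v' p (u' p x) = 0.
Variables (a : modMap A A') (b : modMap B B').
Hypothesis bu : forall p (x : A p), b p (u p x) = u' p (a p x).
Hypothesis vb : forall p (x : B p), v' p (b p x) = 0.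

Definition cx3_map (i : int) : modMap (cx3_obj A B (zeroSheaf X) i) (cx3_obj A' B' C' i) :=
  match i return modMap (cx3_obj A B (zeroSheaf X) i) (cx3_obj A' B' C' i) with
  | Negz 0 => a
  | Posz 0 => b
  | _ => zeroMap _ _
  end.

Fact cx3_map_comm i p (x : cx3_obj A B (zeroSheaf X) i p) :
  cx3_map (i + 1) p (cx3_d u v i p x) = cx3_d u' v' i p (cx3_map i p x).
Proof.
case: i x => [[|[|m]]|[|m]] x //=.
- by rewrite [RHS]vb.
- exact: bu.
- exact: raddf0.
Qed.

Definition cx3_chain : chainMap (cx3 vu) (cx3 vu') :=
  @ChainMap k X (cx3 vu) (cx3 vu') cx3_map cx3_map_comm.

Hypothesis a_inj : forall p (x : A p), a p x = 0 -> x = 0.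
Hypothesis a_surj : forall p (y : A' p), exists x, a p x = y.
Hypothesis b_inj : forall p (x : B p), b p x = 0 -> x = 0.
Hypothesis b_ker : forall p (y : B' p), v' p y = 0 -> exists x, b p x = y.
Hypothesis v_surj : forall p (y : C' p), exists x, v' p x = y.

(** The cohomology of the source is that of [u], and the target is exact in
    degree 1. In degree 0 the cocycles of both sides are identified by [b], and
    the coboundaries by [a]. *)
Lemma cx3_quasi_iso : quasi_iso cx3_chain.
Proof.
have z0 p (x y : zeroSheaf X p) : x = y by apply/rowP; case.
(* The index [i] stands for the cohomology in degree [i + 1]; both complexes *)
(* vanish in this degree unless [i] is [Posz 0], [Negz 0] or [Negz 1]. *)
case=> [[|[|m]]|[|[|m]]] p; split.
- by move=> x _ _; exists 0; apply: z0.
- move=> y _; exists 0 => //; have [x <-] := v_surj y; exists x.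
  by rewrite [RHS](_ : _ = 0 + v' p x) ?add0r.
- by move=> x _ _; exists 0; apply: z0.
- by move=> y _; exists 0 => //; exists 0; apply: z0.
- by move=> x _ _; exists 0; apply: z0.
- by move=> y _; exists 0 => //; exists 0; apply: z0.
- move=> x _ [y]; have [z <-] := a_surj y => e; exists z; apply: subr0_eq.
  apply: b_inj; rewrite linearB; apply/eqP; rewrite subr_eq0; apply/eqP.
  by apply: etrans e _; rewrite [RHS]bu.
- move=> y /b_ker [x ex]; exists x => //; exists 0.
  by rewrite -ex [X in _ = _ + X]raddf0 addr0.
- move=> x _ [y]; have -> : y = 0 by apply: z0.
  rewrite [X in _ = X -> _]raddf0 => /a_inj ->; exists 0; by rewrite [RHS]raddf0.
- move=> y uy; have [x ex] := a_surj y; exists x; last first.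
    by exists 0; rewrite [X in _ = _ + X]raddf0 addr0 -ex.
  by apply: b_inj; rewrite [LHS]bu ex; exact: uy.
- by move=> x _ _; exists 0; apply: z0.
- by move=> y _; exists 0 => //; exists 0; apply: z0.
Qed.

End ThreeTermQuasiIso.

(** * The hypersurface *)

Section Polynomials.
Variables (k : fieldType) (n : nat).
Local Notation R := {mpoly k[n.+1]}.

Lemma pihomogMr d e (g f : R) : f \is d.-homog ->
  pihomog mdeg e (g * f) =
  if (d <= e)%N then pihomog mdeg (e - d) g * f else 0.
Proof.
move=> hf; rewrite [g in LHS](pihomog_partitionE (leq_maxl (msize g) e.+1)).
rewrite mulr_suml raddf_sum /=.
have hj j : pihomog mdeg j g * f \is (j + d).-homog.
  by apply: dhomogM => //; apply: pihomogP.
case: leqP => [de|ed].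
  have lt : (e - d < maxn (msize g) e.+1)%N by rewrite leq_max ltnS leq_subr orbT.
  rewrite (bigD1 (Ordinal lt)) //= pihomog_dE; last by rewrite -{2}(subnK de).
  rewrite big1 ?addr0 // => j ne; apply: pihomog_ne0 (hj j).
  apply: contraNneq ne => ej; apply/eqP/val_inj; exact: canRL (addnK _) ej.
rewrite big1 // => j _; apply: pihomog_ne0 (hj j).
by rewrite gtn_eqF // (leq_trans ed) // leq_addl.
Qed.

(** The quotient of a form by a form may be taken to be a form: keep only its
    component of the right degree. *)
Lemma homog_dvd d (e : int) (a h f : R) : f \is d.-homog ->
  homog_elt (polyAlg k n) e a -> a = h * f ->
  exists2 g, homog_elt (polyAlg k n) (e - d%:Z) g & a = g * f.
Proof.
move=> hf; case: e => e /= ha eah; last first.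
  by exists 0; [exact: (poly_hom0 k n)|rewrite mul0r].
have := pihomogMr e h hf; rewrite -eah pihomog_dE //.
case: leqP => [de ->|_ ->]; last first.
  by exists 0; [exact: (poly_hom0 k n)|rewrite mul0r].
by exists (pihomog mdeg (e - d) h) => //; rewrite subzn //; apply: pihomogP.
Qed.

Lemma poly_gen (Q : nat -> R -> Prop) : (forall m, Q m 0) ->
  (forall c, Q 0%N c%:MP) ->
  (forall m a b, Q m a -> Q m b -> Q m (a + b)) ->
  (forall m l a, Q m a -> Q m.+1 ('X_l * a)) ->
  forall m a, homog_elt (polyAlg k n) (Posz m) a -> Q m a.
Proof.
move=> Q0 QC QD QX m a /dhomogP ha.
have Qmon c t : Q (mdeg t) (c *: 'X_[t]).
  move: {2}(mdeg t) (erefl (mdeg t)) => e; elim: e t => [|e IH] t et.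
    by have /eqP := et; rewrite mdeg_eq0 => /eqP ->; rewrite mdeg0 mpolyX0 alg_mpolyC.
  have [i ti] : exists i, t i != 0%N.
    apply: contrapT => /forallNP h; have : t = 0%MM.
      by apply/mnmP => i; rewrite mnm0E; apply/eqP/negPn/negP/h.
    by move=> t0; rewrite t0 mdeg0 in et.
  have ut : (U_(i) <= t)%MM by rewrite lep1mP.
  rewrite -(submK ut) addmC mdegD mdeg1 add1n mpolyXD scalerAr.
  apply/QX/IH; apply: succn_inj.
  by rewrite -et -[in RHS](submK ut) mdegD mdeg1 addn1.
rewrite (mpolyE a) big_seq; apply: (big_ind (Q m)) => //; first exact: QD.
by move=> t /ha <-; apply: Qmon.
Qed.

Lemma polyX_hom (i : 'I_n.+1) : homog_elt (polyAlg k n) 1 ('X_i : R).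
Proof. by rewrite /= dhomogX /= mdeg1. Qed.

End Polynomials.

Section Hypersurface.
Variables (k : fieldType) (n : nat) (H : hypersurface k n).
Local Notation F := (hs_form H).
Local Notation d := (hs_deg H).

Lemma hs_form_reg a : a * F = 0 -> a = 0.
Proof.
have F0 : F != 0.
  apply/eqP => F0; have := hs_x0 H; rewrite F0 mcoeff0 => /esym/eqP.
  by rewrite oner_eq0.
by move=> /eqP; rewrite mulf_eq0 (negPf F0) orbF => /eqP.
Qed.

Lemma coordProj_form : coordProj H F = 0.
Proof. by apply/coordProj_eq0; exists 1; rewrite mul1r. Qed.

Lemma coordProj_ker e a : homog_elt (polyAlg k n) e a -> coordProj H a = 0 ->
  exists2 g, homog_elt (polyAlg k n) (e - d%:Z) g & a = g * F.
Proof. by move=> ha /coordProj_eq0 [h]; apply: homog_dvd (hs_homog H) ha. Qed.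

Local Notation A := (polyAlg k n).
Local Notation B := (coordAlg H).

Let phiC (c : k) : coordProj H (ga_const A c) = ga_const B c := erefl.
Let dl (i : 'I_n.+1) : {additive A -> A} := mderiv i.

Fact pderivative_mul i (a b : A) : dl i (a * b) = dl i a * b + a * dl i b.
Proof. exact: mderivM. Qed.

Fact pderivative_const i c : dl i (ga_const A c) = 0.
Proof. exact: mderivC. Qed.

Fact pderivative_hom i m a : homog_elt A m a -> homog_elt A (m - 1) (dl i a).
Proof.
case: m => [[|m]|m] /= ha.
- have -> : a = (a@_0)%:MP; last by rewrite mderivC; apply: (poly_hom0 k n (0-1)).
  apply/mpolyP => m; rewrite mcoeffC; have [->|m0] := eqVneq; first by rewrite mulr1.
  by rewrite mulr0; apply: (dhomog_nemf_coeff ha); rewrite /= mdeg_eq0.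
- by rewrite subn1; apply: mderiv_homog.
- by rewrite ha mderiv0.
Qed.

Fact pderivative_var i l : dl i ('X_l : {mpoly k[n.+1]}) = (i == l)%:R.
Proof.
rewrite -[LHS]/(('X_l : {mpoly k[n.+1]})^`M(i)).
rewrite mderivX mnm1E eq_sym; case: eqP => [->|_]; last by rewrite scale0r.
by rewrite -{1}[U_(l)%MM]add0m addmK mpolyX0 scale1r.
Qed.

Definition hyp_quot : modMap (conormal (hypImm H)) (twist B (- d%:Z)) :=
  formQuotMap (A := A) (B := B) (phi := coordProj H) phiC
    (@coordProj_hom _ _ H) (@coordProj_hom_surj _ _ H) hs_form_reg coordProj_ker.

Definition hyp_grad : modMap (pullback (hypImm H) (Omega (projSpace k n)))
    (powSheaf (twist B (- 1)) n.+1) :=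
  gradMap (A := A) (B := B) (phi := coordProj H) phiC
    (@coordProj_hom _ _ H) (@coordProj_hom_surj _ _ H)
    pderivative_mul pderivative_const pderivative_hom.

Lemma hyp_grad_conormal p (c : conormal (hypImm H) p) :
  hyp_grad p (conormalMap (hypImm H) p c) = dual_u H p (hyp_quot p c).
Proof.
exact: (gradMap_conormal (A := A) (B := B) (phi := coordProj H) (phiC := phiC)
  hs_form_reg coordProj_form coordProj_ker pderivative_mul pderivative_const
  pderivative_hom (partial_hom H)).
Qed.

Lemma dual_v_grad p (w : pullback (hypImm H) (Omega (projSpace k n)) p) :
  dual_v H p (hyp_grad p w) = 0.
Proof.
exact: (eulerMap_grad (A := A) (B := B) (phi := coordProj H) (phiC := phiC)
  (@poly_gen k n) pderivative_mul pderivative_const pderivative_hom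
  pderivative_var (coordX_hom H)).
Qed.

Lemma hyp_chart (p : projPt B) : exists j, ~ p (coordProj H 'X_j).
Proof.
exact: (chart_exists (A := A) (B := B) (phi := coordProj H)
  (@coordProj_hom_surj _ _ H) (@poly_gen k n) p).
Qed.

Lemma hyp_quot_inj (p : projPt B) (c : conormal (hypImm H) p) :
  hyp_quot p c = 0 -> c = 0.
Proof.
have [j pj] := hyp_chart p.
have Xj_hom : homog_elt A (Posz d) ('X_j ^+ d : {mpoly k[n.+1]}).
  by have := dhomogMn d (polyX_hom k j); rewrite mul1n.
apply: (formQuotMap_inj (A := A) (B := B) (phi := coordProj H) (phiC := phiC)
  (hs_homog H) coordProj_form Xj_hom).
rewrite rmorphXn; elim: {Xj_hom} d => [|e IH]; first exact: pt1.
by rewrite exprS; apply: ptMN.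
Qed.

Lemma hyp_quot_surj (p : projPt B) (y : twist B (- d%:Z) p) :
  exists c, hyp_quot p c = y.
Proof.
exact: (formQuotMap_surj (A := A) (B := B) (phi := coordProj H) phiC
  (@coordProj_hom _ _ H) (@coordProj_hom_surj _ _ H)
  (hs_homog H) hs_form_reg coordProj_form coordProj_ker).
Qed.

Lemma hyp_grad_inj (p : projPt B) (w : pullback (hypImm H) (Omega (projSpace k n)) p) :
  hyp_grad p w = 0 -> w = 0.
Proof.
have [j pj] := hyp_chart p.
exact: (gradMap_inj (@polyX_hom k n) (@poly_gen k n) pderivative_var pj).
Qed.

Lemma hyp_grad_ker (p : projPt B) (y : powSheaf (twist B (- 1)) n.+1 p) :
  dual_v H p y = 0 -> exists w, hyp_grad p w = y.
Proof.
have [j pj] := hyp_chart p => vy.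
eexists.
exact: (gradMap_inv (A := A) (B := B) (phi := coordProj H) phiC
  (@coordProj_hom _ _ H) (@coordProj_hom_surj _ _ H) (@polyX_hom k n)
  pderivative_mul pderivative_const
  pderivative_hom pderivative_var (phiX_hom := coordX_hom H) pj vy).
Qed.

Lemma dual_v_surj (p : projPt B) (y : twist B 0 p) : exists x, dual_v H p x = y.
Proof.
have [j pj] := hyp_chart p.
exact: (eulerMap_surj (A := A) (B := B) (phi := coordProj H)
  (@coordProj_hom _ _ H) (@polyX_hom k n) (coordX_hom H) pj).
Qed.

End Hypersurface.

Theorem proposition4p4 (k : closedFieldType) (char0 : [pchar k] =i pred0)
    (n : nat) (n_gt0 : (0 < n)%N) (X : hypersurface k n) :
  exists phi : chainMap (cotangentComplex X) (dualComplex X), quasi_iso phi.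
Proof.
exists (cx3_chain (@cotangent_dd _ _ X) (@dual_vu _ _ X)
  (@hyp_grad_conormal _ _ X) (@dual_v_grad _ _ X)).
apply: cx3_quasi_iso.
- exact: hyp_quot_inj.
- exact: hyp_quot_surj.
- exact: hyp_grad_inj.
- exact: hyp_grad_ker.
- exact: dual_v_surj.
Qed.
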